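(* Let $K$ be a field of characteristic $0$. For a positive integer $n$ with $n \geq 4$, let $L_n$ be the free Lie algebra over $K$ freely generated by $x_1,\ldots,x_n$, and let $R_n = L_n/(\gamma_3(L_n') + (\gamma_3(L_n))')$ be the free (nilpotent of class 2)-by-abelian and abelian-by-(nilpotent of class 2) Lie algebra of rank $n$, freely generated by $\{y_1,\ldots,y_n\}$ with $y_i = x_i + (\gamma_3(L_n') + (\gamma_3(L_n))')$, $i=1,\ldots,n$. For each $\kappa \geq 1$ let $\omega_\kappa$ be the automorphism of $R_n$ with $\omega_\kappa(y_1) = y_1 + [y_1, y_2, {}_{(\kappa-1)}y_1, [y_3,y_4]]$ and $\omega_\kappa(y_j) = y_j$ for $j = 2,\ldots,n$. Then the subgroup of $\mathrm{Aut}(R_n)$ generated by the group $T_{R_n}$ of tame automorphisms of $R_n$ together with $\omega_1,\omega_2,\ldots$ is dense in $\mathrm{Aut}(R_n)$ with respect to the formal power series topology.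
   Context: For a Lie algebra $L$, $\gamma_c(L)$ is the $c$-th term of the lower central series and $L'=\gamma_2(L)$. Commutators are left-normed, and $[a,{}_{m}b]$ denotes the left-normed commutator of $a$ followed by $m$ copies of $b$ (equal to $a$ if $m=0$); thus $[y_1,y_2,{}_{(\kappa-1)}y_1,[y_3,y_4]] = [[y_1,y_2,y_1,\ldots,y_1],[y_3,y_4]]$ with $\kappa-1$ copies of $y_1$ after $y_2$. Tame automorphisms: the natural epimorphism $L_n \to R_n$ induces a group homomorphism $\mathrm{Aut}(L_n)\to\mathrm{Aut}(R_n)$; its image is $T_{R_n}$ and its elements are called tame. Formal power series topology: give $R_n$ the topology corresponding to the series $R_n \supseteq \gamma_2(R_n)\supseteq\gamma_3(R_n)\supseteq\cdots$ (these ideals form a base of neighbourhoods of $0$). Identify $\mathrm{End}(R_n)$ (Lie algebra endomorphisms) with the direct product $R_n\times\cdots\times R_n$ ($n$ copies) via $\phi\mapsto(\phi(y_1),\ldots,\phi(y_n))$ and give it the product topology; $\mathrm{Aut}(R_n)\subseteq \mathrm{End}(R_n)$ has the subspace topology. *)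

(* Defs.v *)
From HB Require Import structures.
From mathcomp Require Import all_boot all_algebra.
From mathcomp Require Import all_classical topology.

Set Implicit Arguments.
Unset Strict Implicit.
Unset Printing Implicit Defensive.

Import GRing.Theory.

Local Open Scope classical_set_scope.
Local Open Scope ring_scope.

HB.mixin Record Lmodule_isLieAlgebra (K : fieldType) L of GRing.Lmodule K L := {
  bracket : L -> L -> L;
  bracket_linearl : forall v : L, linear (bracket^~ v);
  bracket_linearr : forall u : L, linear (bracket u);
  bracketxx : forall u : L, bracket u u = 0;
  jacobi : forall u v w : L,
    bracket u (bracket v w) + bracket v (bracket w u)
      + bracket w (bracket u v) = 0
}.

#[short(type="lieAlgType")]
HB.structure Definition LieAlgebra (K : fieldType) :=
  {L of GRing.Lmodule K L & Lmodule_isLieAlgebra K L}.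

(* [lie u, v, .., w] is the left-normed commutator. *)
Notation "[ 'lie' u , v , .. , w ]" := (bracket .. (bracket u v) .. w)
  (at level 0, u, v, w at level 99,
   format "[ 'lie'  '[' u ,  v ,  .. ,  w ']' ]") : ring_scope.

(* The left-normed commutator [a, b, .., b] with m copies of b. *)
Definition bracket_iter (K : fieldType) (L : lieAlgType K) (a : L) (m : nat)
    (b : L) : L :=
  iter m (fun u => [lie u, b]) a.

Section Subspaces.
Variables (K : fieldType) (L : lieAlgType K).
Implicit Types A B : set L.

Definition is_subspace A : Prop :=
  A 0 /\ forall (a : K) (u v : L), A u -> A v -> A (a *: u + v).

Definition lin_span A : set L := smallest is_subspace A.

Definition lie_prod A B : set L :=
  lin_span [set [lie u, v] | u in A & v in B].

(* The c-th term, c >= 1, of the lower central series of the subalgebra A. *)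
Definition lcs A (c : nat) : set L := iter c.-1 (fun B => lie_prod B A) A.

Definition gamma (c : nat) : set L := lcs setT c.

Definition derived A : set L := lie_prod A A.

Definition subspace_sum A B : set L := [set u + v | u in A & v in B].

Lemma lin_span_subspace A : is_subspace (lin_span A).
Proof.
split=> [B [[B0 _] _] //|a u v Au Av B BA].
by have [[_ +] _] := BA; apply; [exact: Au|exact: Av].
Qed.

Lemma lie_prodS A A' B : A `<=` A' -> lie_prod A B `<=` lie_prod A' B.
Proof.
move=> AA' u Au C [Csub C_sub]; apply: Au; split=> // _ [v Av [w Bw <-]].
by apply: C_sub; exists v; [exact: AA'|exists w].
Qed.

Lemma gamma_subspace c : is_subspace (gamma c).
Proof.
by rewrite /gamma /lcs; case: c.-1 => [|m] //; exact: lin_span_subspace.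
Qed.

Lemma gamma_decr : {homo gamma : c d / (c <= d)%N >-> d `<=` c}.
Proof.
have iterS m : iter m.+1 (fun B => lie_prod B setT) setT
    `<=` iter m (fun B => lie_prod B (@setT L)) setT.
  by elim: m => [//|m IHm]; rewrite iterS [X in _ `<=` X]iterS; apply: lie_prodS.
move=> c d le_cd; rewrite /gamma /lcs; have: (c.-1 <= d.-1)%N.
  by rewrite -!subn1 leq_sub2r.
elim: d.-1 => [|m IHm]; first by rewrite leqn0 => /eqP ->.
rewrite leq_eqVlt => /orP[/eqP -> //|/IHm sub_m].
exact: subset_trans (iterS m) sub_m.
Qed.

End Subspaces.

Arguments gamma {K} L c _.

Section Morphisms.
Variables (K : fieldType).

Definition lie_hom (L M : lieAlgType K) (f : L -> M) : Prop :=
  linear f /\ {morph f : u v / [lie u, v]}.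

(* L is freely generated, as a Lie algebra over K, by x_0, .., x_(n-1). *)
Definition free_on (n : nat) (L : lieAlgType K) (x : 'I_n -> L) : Prop :=
  forall (M : lieAlgType K) (m : 'I_n -> M),
    exists! f : L -> M, lie_hom f /\ forall i, f (x i) = m i.

(* pi presents R as the quotient of L by I. *)
Definition is_quotient (L R : lieAlgType K) (I : set L) (pi : L -> R) : Prop :=
  [/\ lie_hom pi, forall r, exists u, pi u = r
    & forall u, pi u = 0 <-> I u].

Record lieEnd (L : lieAlgType K) := LieEnd {
  end_fun :> L -> L;
  end_hom : lie_hom end_fun
}.

HB.instance Definition _ (L : lieAlgType K) := gen_eqMixin (lieEnd L).
HB.instance Definition _ (L : lieAlgType K) := gen_choiceMixin (lieEnd L).

Record lieAut (L : lieAlgType K) := LieAut {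
  aut_fun :> L -> L;
  aut_inv : L -> L;
  aut_hom : lie_hom aut_fun;
  aut_funK : cancel aut_fun aut_inv;
  aut_invK : cancel aut_inv aut_fun
}.

HB.instance Definition _ (L : lieAlgType K) := gen_eqMixin (lieAut L).
HB.instance Definition _ (L : lieAlgType K) := gen_choiceMixin (lieAut L).

Definition end_of_aut (L : lieAlgType K) (phi : lieAut L) : lieEnd L :=
  LieEnd (aut_hom phi).

Lemma lieAut_eq (L : lieAlgType K) (phi psi : lieAut L) :
  phi =1 psi -> phi = psi.
Proof.
case: phi psi => [f f' fh fK f'K] [g g' gh gK g'K] /= /funext eq_fg; subst g.
have eq_inv : f' = g'.
  by apply/funext => u; rewrite -[in LHS](g'K u) fK.
subst g'; congr LieAut; exact: Prop_irrelevance.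
Qed.

End Morphisms.

Section AutGroup.
Variables (K : fieldType) (L : lieAlgType K).
Implicit Types phi psi : lieAut L.

Lemma lie_hom_id : lie_hom (@id L).
Proof. by []. Qed.

Lemma lie_hom_comp phi psi : lie_hom (phi \o psi).
Proof.
have [[lf mf] [lg mg]] := (aut_hom phi, aut_hom psi).
by split=> [a u v|u v] /=; [rewrite lg lf|rewrite mg mf].
Qed.

Lemma lie_hom_inv phi : lie_hom (aut_inv phi).
Proof.
have [[[lf mf] fK] f'K] := (aut_hom phi, aut_funK phi, aut_invK phi).
split=> [a u v|u v]; apply: (can_inj fK).
  by rewrite lf !f'K.
by rewrite mf !f'K.
Qed.

Definition aut_one : lieAut L :=
  @LieAut K L id id lie_hom_id (fun=> erefl) (fun=> erefl).

Definition aut_mul phi psi : lieAut L :=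
  LieAut (lie_hom_comp phi psi)
    (can_comp (aut_funK phi) (aut_funK psi))
    (can_comp (aut_invK psi) (aut_invK phi)).

Definition aut_V phi : lieAut L :=
  LieAut (lie_hom_inv phi) (aut_invK phi) (aut_funK phi).

Fact aut_mulA : associative aut_mul.
Proof. by move=> f g h; apply: lieAut_eq. Qed.

Fact aut_mul1 : left_id aut_one aut_mul.
Proof. by move=> f; apply: lieAut_eq. Qed.

Fact aut_mulr1 : right_id aut_one aut_mul.
Proof. by move=> f; apply: lieAut_eq. Qed.

Fact aut_mulV : left_inverse aut_one aut_V aut_mul.
Proof. by move=> f; apply: lieAut_eq => u /=; rewrite aut_funK. Qed.

Fact aut_mulrV : right_inverse aut_one aut_V aut_mul.
Proof. by move=> f; apply: lieAut_eq => u /=; rewrite aut_invK. Qed.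

HB.instance Definition _ := isGroup.Build (lieAut L)
  aut_mulA aut_mul1 aut_mulr1 aut_mulV aut_mulrV.

End AutGroup.

Definition generated_subgroup (G : groupType) (S : set G) : set G :=
  smallest [set H : set G | group_closed (mem H)] S.

Section Topology.
Variables (K : fieldType) (R : lieAlgType K).

(* R with the topology in which the cosets u + gamma c, c >= 1, form a base
   of neighbourhoods of u. *)
Definition power_series_topology : Type := R.
Local Notation T := power_series_topology.

HB.instance Definition _ := Choice.on T.

Definition ps_nbhs (u : T) : set_system T :=
  [set U | exists2 c, (1 <= c)%N & forall v : R, gamma R c v -> U ((u : R) + v)].

HB.instance Definition _ := hasNbhs.Build T ps_nbhs.

Fact ps_nbhs_filter (u : T) : ProperFilter (nbhs u).
Proof.
split=> [[c _ /(_ 0)]|].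
  by apply; have [] := gamma_subspace R c.
split=> [|U V [c c1 cU] [d d1 dV]|U V UV [c c1 cU]].
- by exists 1.
- exists (maxn c d) => [|v cdv]; first by rewrite leq_max c1.
  split; [apply: cU|apply: dV]; move: v cdv; apply: gamma_decr.
    exact: leq_maxl.
  exact: leq_maxr.
- by exists c => // v /cU /UV.
Qed.

Fact ps_nbhs_singleton (u : T) (U : set T) : nbhs u U -> U u.
Proof.
case=> c _ /(_ 0); rewrite addr0; apply.
by have [] := gamma_subspace R c.
Qed.

Fact ps_nbhs_nbhs (u : T) (U : set T) : nbhs u U -> nbhs u (nbhs^~ U).
Proof.
case=> c c1 cU; exists c => // v cv; exists c => // w cw.
rewrite -addrA; apply: cU; rewrite -[v]scale1r.
by have [_] := gamma_subspace R c; apply.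
Qed.

HB.instance Definition _ := Nbhs_isNbhsTopological.Build T
  ps_nbhs_filter ps_nbhs_singleton ps_nbhs_nbhs.

Variables (n : nat) (y : 'I_n -> R).

(* The identification of End(R) with R x .. x R (n copies), injective when y
   generates R. *)
Definition end_coords (phi : lieEnd R) :
    prod_topology (fun _ : 'I_n => power_series_topology) :=
  fun i => phi (y i).

Definition end_topology : topologicalType := initial_topology end_coords.

(* Aut(R) as a subspace of End(R). *)
Definition aut_topology : topologicalType :=
  initial_topology (@end_of_aut K R : lieAut R -> end_topology).

End Topology.

Section Statement.
Variables (K : fieldType).

Definition relation_ideal (L : lieAlgType K) : set L :=
  subspace_sum (lcs (gamma L 2) 3) (derived (gamma L 3)).

(* The image of Aut(L) in Aut(R), where pi is the projection of L onto R. *)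
Definition tame (L R : lieAlgType K) (pi : L -> R) : set (lieAut R) :=
  [set phi | exists psi : lieAut L, forall u, phi (pi u) = pi (psi u)].

(* w y_1 = y_1 + [y_1, y_2, y_1, .., y_1, [y_3, y_4]] with kappa - 1 copies of
   y_1 after y_2, and w fixes the other generators; y_i has index i - 1. *)
Definition is_omega (R : lieAlgType K) (n : nat) (hn : (4 <= n)%N)
    (y : 'I_n -> R) (kappa : nat) (w : lieAut R) : Prop :=
  let idx k (hk : (k < 4)%N) := widen_ord hn (Ordinal hk) in
  let i1 := @idx 0 isT in let i2 := @idx 1 isT in
  let i3 := @idx 2 isT in let i4 := @idx 3 isT in
  w (y i1) = y i1 + [lie bracket_iter [lie y i1, y i2] kappa.-1 (y i1),
                         [lie y i3, y i4]]
  /\ forall j, j != i1 -> w (y j) = y j.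

Definition omegas (R : lieAlgType K) (n : nat) (hn : (4 <= n)%N)
    (y : 'I_n -> R) : set (lieAut R) :=
  [set w | exists2 kappa, (1 <= kappa)%N & is_omega hn y kappa w].

End Statement.

Arguments relation_ideal {K} L _.

(* Main.v *)
Require Import Defs.
From HB Require Import structures.
From mathcomp Require Import all_boot all_algebra all_fingroup.
From mathcomp Require Import all_classical topology.
From mathcomp Require Import mpoly zify.

(** The second derived algebra R'' is central in R', and two commutators of weight
    at least 3 commute; hence R'' is spanned by the brackets [v, f] with v = [y_a, y_b] and
    f = [y_c, y_d, y_p1, y_p2, ...], and in such a bracket the letters y_p behave like
    commuting variables.

    The subgroup H is dense if and only if every automorphism can be approximated
    by elements of H modulo each term of the lower central series. Linear
    automorphisms settle weight 1. After that only the leading terms of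
    automorphisms y_i |-> y_i + u_i matter, where the tuple u is regarded as the
    derivation y_i |-> u_i, homogeneous modulo higher weight. The leading terms of
    elements of H form a vector space (leadingD, leadingZ) that is closed under
    brackets with elementary derivations (leading_bracket) and under the Lie
    algebra of the general linear group, which acts by polarization
    (leading_polarize).

    An obstruction. The Magnus embedding assigns to an automorphism its Jacobian
    matrix over a polynomial ring. This matrix is invertible, so its determinant
    is constant, and therefore the leading term has trace zero
    (automorphism_trace).

    Conversely every tuple of trace zero is a leading term of H. For tuples with
    values in R'' there is no condition, which is where the automorphisms omega_k
    are needed: polarizing their leading terms gives all [v, f] d/dy_i with v
    free of y_i (X1_avoiding); the class of [[y_i, y_c], f] d/dy_i does not depend
    on i (X_move_index), and brackets with the tame derivations [y_a, y_b] d/dy_j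
    show by induction on the weight that it vanishes (reached_with_all). Modulo
    R'', brackets and polarizations of tame derivations give all
    [y_a, y_b] p d/dy_i with a and b different from i (X1_traceless), and then the
    class of [y_i, y_a] p d/dy_i depends only on the monomial y_a p, which is its
    trace (X_monomial). So a tuple of trace zero has class zero (X_of_trace). Rank 4
    enters through the choice of a generator outside three given ones. *)

Set Implicit Arguments.
Unset Strict Implicit.
Unset Printing Implicit Defensive.

Import GRing.Theory.

Local Open Scope classical_set_scope.
Local Open Scope ring_scope.

(** * Deciding identities of abelian groups *)

Inductive zexpr := ZVar of nat | ZZero | ZAdd of zexpr & zexpr | ZOpp of zexpr
  | ZMuln of zexpr & nat.

Fixpoint zeval (V : zmodType) (e : seq V) (t : zexpr) : V :=
  match t with
  | ZVar i => nth 0 e i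
  | ZZero => 0
  | ZAdd t1 t2 => zeval e t1 + zeval e t2
  | ZOpp t1 => - zeval e t1
  | ZMuln t1 n => zeval e t1 *+ n
  end.

Fixpoint zcoef (t : zexpr) (i : nat) : int :=
  match t with
  | ZVar j => (i == j)%:Z
  | ZZero => 0
  | ZAdd t1 t2 => zcoef t1 i + zcoef t2 i
  | ZOpp t1 => - zcoef t1 i
  | ZMuln t1 n => zcoef t1 i *+ n
  end.

Lemma zevalE (V : zmodType) (e : seq V) t :
  zeval e t = \sum_(i < size e) nth 0 e i *~ zcoef t i.
Proof.
elim: t => [j||t1 IH1 t2 IH2|t1 IH1|t1 IH1 k] /=.
- case: (ltnP j (size e)) => [lt_j|le_j]; last first.
    rewrite nth_default // big1 // => i _.
    by rewrite (ltn_eqF (leq_trans (ltn_ord i) le_j)).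
  rewrite (bigD1 (Ordinal lt_j)) //= eqxx big1 ?addr0 // => i.
  by rewrite -val_eqE /= => /negPf ->.
- by rewrite big1.
- by rewrite IH1 IH2 -big_split; apply: eq_bigr => i _; rewrite mulrzDr.
- by rewrite IH1 -sumrN; apply: eq_bigr => i _; rewrite mulrNz.
- rewrite IH1 -sumrMnl; apply: eq_bigr => i _.
  by rewrite -mulr_natr natz mulrzA pmulrn.
Qed.

(** An identity between sums and differences of atoms holds in every abelian
    group once the integer coefficients of each atom agree, which is decided by
    computation. *)
Lemma zeval_eq (V : zmodType) (e : seq V) t1 t2 :
  all (fun i => zcoef t1 i == zcoef t2 i) (iota 0 (size e)) ->
  zeval e t1 = zeval e t2.
Proof.
move/allP=> eq12; rewrite !zevalE; apply: eq_bigr => i _.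
by rewrite (eqP (eq12 i _)) // mem_iota /=.
Qed.

Ltac zmem x e k :=
  lazymatch e with
  | ?h :: ?e' => tryif unify h x then k constr:(Some 0%N)
      else zmem x e' ltac:(fun r =>
      lazymatch r with Some ?i => k constr:(Some i.+1) | _ => k r end)
  | _ => k constr:(@None nat)
  end.

Ltac zatom t e k :=
  zmem t e ltac:(fun r => lazymatch r with
      | Some ?i => k constr:(ZVar i) e
      | None => let e' := eval cbn [cat] in (e ++ [:: t]) in
                let m := eval cbn [size] in (size e) in k constr:(ZVar m) e'
      end).

Ltac znumeral n :=
  lazymatch n with O => idtac | S ?m => znumeral m end.

Ltac zquote t e k :=
  lazymatch t with
  | 0 => k constr:(ZZero) e
  | ?a + ?b => zquote a e ltac:(fun ta e1 => zquote b e1 ltac:(fun tb e2 =>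
      k constr:(ZAdd ta tb) e2))
  | - ?a => zquote a e ltac:(fun ta e1 => k constr:(ZOpp ta) e1)
  | ?a *+ ?n => tryif znumeral n
      then zquote a e ltac:(fun ta e1 => k constr:(ZMuln ta n) e1)
      else zatom t e k
  | _ => zatom t e k
  end.
Ltac zmodule :=
  lazymatch goal with |- @eq ?T ?a ?b =>
    let V := constr:(GRing.Zmodule.clone T _) in
    zquote a (@nil T) ltac:(fun ta e => zquote b e ltac:(fun tb e' =>
      exact: (@zeval_eq V e' ta tb isT)))
  end.

(** * Lie algebras and their lower central series *)

Section LieBasics.
Variables (K : fieldType) (L : lieAlgType K).
Implicit Types u v w : L.

Lemma lieDl w u v : [lie u + v, w] = [lie u, w] + [lie v, w].
Proof. by have := bracket_linearl w 1 u v; rewrite !scale1r. Qed.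

Lemma lieDr w u v : [lie w, u + v] = [lie w, u] + [lie w, v].
Proof. by have := bracket_linearr w 1 u v; rewrite !scale1r. Qed.

Lemma lie0l w : [lie 0, w] = 0.
Proof. by apply: (addrI [lie 0, w]); rewrite -lieDl !addr0. Qed.

Lemma lie0r w : [lie w, 0] = 0.
Proof. by apply: (addrI [lie w, 0]); rewrite -lieDr !addr0. Qed.

Lemma lieZl a u w : [lie a *: u, w] = a *: [lie u, w].
Proof. by have := bracket_linearl w a u 0; rewrite lie0l !addr0. Qed.

Lemma lieZr a u w : [lie w, a *: u] = a *: [lie w, u].
Proof. by have := bracket_linearr w a u 0; rewrite lie0r !addr0. Qed.

Lemma lieNl u w : [lie - u, w] = - [lie u, w].
Proof. by rewrite -scaleN1r lieZl scaleN1r. Qed.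

Lemma lieNr u w : [lie w, - u] = - [lie w, u].
Proof. by rewrite -scaleN1r lieZr scaleN1r. Qed.

Lemma lieBl w u v : [lie u - v, w] = [lie u, w] - [lie v, w].
Proof. by rewrite lieDl lieNl. Qed.

Lemma lieBr w u v : [lie w, u - v] = [lie w, u] - [lie w, v].
Proof. by rewrite lieDr lieNr. Qed.

Lemma lieC u v : [lie u, v] = - [lie v, u].
Proof.
have := bracketxx (u + v); rewrite lieDl !lieDr !bracketxx add0r addr0.
by move/eqP; rewrite addr_eq0 => /eqP.
Qed.

Lemma lie_leibniz u v w : [lie u, v, w] = [lie [lie u, w], v] + [lie u, [lie v, w]].
Proof.
have /eqP := jacobi u v w; rewrite addr_eq0 => /eqP jac.
by rewrite (lieC _ w) -jac (lieC _ v) (lieC u w) lieNr opprK addrC.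
Qed.

Lemma lie_jacobi u v w : [lie u, v, w] = [lie u, w, v] - [lie v, w, u].
Proof. by rewrite lie_leibniz (lieC u [lie v, w]). Qed.

End LieBasics.

Section SubspaceFacts.
Variables (K : fieldType) (L : lieAlgType K) (S : set L).
Hypothesis S_sub : is_subspace S.

Lemma subspace0 : S 0. Proof. exact: S_sub.1. Qed.

Lemma subspaceD u v : S u -> S v -> S (u + v).
Proof. by move=> Su Sv; rewrite -[u]scale1r; apply: S_sub.2. Qed.

Lemma subspaceZ a u : S u -> S (a *: u).
Proof. by move=> Su; rewrite -[a *: u]addr0; apply: S_sub.2 => //; exact: subspace0. Qed.

Lemma subspaceN u : S u -> S (- u).
Proof. by rewrite -scaleN1r; exact: subspaceZ. Qed.

Lemma subspaceB u v : S u -> S v -> S (u - v).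
Proof. by move=> Su /subspaceN; exact: subspaceD. Qed.

Lemma lin_span_sub (A : set L) : A `<=` S -> lin_span A `<=` S.
Proof. by move=> AS u; apply; split. Qed.

End SubspaceFacts.

Section Gamma.
Variables (K : fieldType) (L : lieAlgType K).
Implicit Types u v w : L.

Lemma lie_prod_lie (A B : set L) u v : A u -> B v -> lie_prod A B [lie u, v].
Proof. by move=> Au Bv C [_]; apply; exists u => //; exists v. Qed.

Lemma gamma_le c d u : (c <= d)%N -> gamma L d u -> gamma L c u.
Proof. by move=> cd; apply: gamma_decr. Qed.

Lemma gamma0 c : gamma L c 0.
Proof. exact: subspace0 (gamma_subspace L c). Qed.

Lemma gammaD c u v : gamma L c u -> gamma L c v -> gamma L c (u + v).
Proof. exact: subspaceD (gamma_subspace L c) _ _. Qed.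

Lemma gammaZ c a u : gamma L c u -> gamma L c (a *: u).
Proof. exact: subspaceZ (gamma_subspace L c) _ _. Qed.

Lemma gammaN c u : gamma L c u -> gamma L c (- u).
Proof. exact: subspaceN (gamma_subspace L c) _. Qed.

Lemma gammaB c u v : gamma L c u -> gamma L c v -> gamma L c (u - v).
Proof. exact: subspaceB (gamma_subspace L c) _ _. Qed.

Lemma gamma_sum c (I : Type) (r : seq I) (P : pred I) (F : I -> L) :
  (forall i, P i -> gamma L c (F i)) -> gamma L c (\sum_(i <- r | P i) F i).
Proof. by apply: big_ind; [exact: gamma0|move=> *; exact: gammaD]. Qed.

Lemma gamma_ind c (S : set L) : is_subspace S ->
  (forall u v, gamma L c.+1 u -> S [lie u, v]) -> gamma L c.+2 `<=` S.
Proof.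
by move=> subS Slie; apply: lin_span_sub => // _ [u cu [v _ <-]]; apply: Slie.
Qed.

(** The definition gives the case where v has weight 1; the Leibniz rule
    [u, [z, w]] = [[u, z], w] - [[u, w], z] lowers the weight of v. *)
Lemma gamma_lie a b u v :
  gamma L a u -> gamma L b v -> gamma L (a + b) [lie u, v].
Proof.
have gamma_lie1 c z w : gamma L c z -> gamma L c.+1 [lie z, w].
  by case: c => [|c] cz; exact: lie_prod_lie.
case: b => [|b].
  by move=> au _; rewrite addn0; apply: gamma_le (leqnSn a) (gamma_lie1 _ _ _ _).
elim: b a u v => [|b IHb] a u v au.
  by rewrite addn1 => _; apply: gamma_lie1.
apply: (gamma_ind (S := fun v => gamma L (a + b.+2) [lie u, v])).
  split=> [|k z w uz uw]; first by rewrite lie0r; exact: gamma0.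
  by rewrite lieDr lieZr; apply: gammaD => //; apply: gammaZ.
move=> z w bz /=; rewrite [X in gamma L _ X](_ : _ =
    [lie u, z, w] - [lie [lie u, w], z]); last by rewrite lie_leibniz addrC addKr.
apply: gammaB; first by rewrite addnS; apply: gamma_lie1; apply: IHb.
by rewrite addnS -addSn; apply: IHb => //; apply: gamma_lie1.
Qed.

Lemma gamma2_lie u v : gamma L 2 [lie u, v].
Proof. exact: (@gamma_lie 1 1). Qed.

End Gamma.

Section Homomorphisms.
Variables (K : fieldType) (L M : lieAlgType K) (f : L -> M).
Hypothesis f_hom : lie_hom f.

Lemma hom_lie u v : f [lie u, v] = [lie f u, f v].
Proof. exact: f_hom.2. Qed.

Lemma homD u v : f (u + v) = f u + f v.
Proof. by have := f_hom.1 1 u v; rewrite !scale1r. Qed.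

Lemma hom0 : f 0 = 0.
Proof. by apply: (addrI (f 0)); rewrite -homD !addr0. Qed.

Lemma homZ a u : f (a *: u) = a *: f u.
Proof. by have := f_hom.1 a u 0; rewrite hom0 !addr0. Qed.

Lemma homN u : f (- u) = - f u.
Proof. by rewrite -!scaleN1r homZ. Qed.

Lemma homB u v : f (u - v) = f u - f v.
Proof. by rewrite homD homN. Qed.

Lemma hom_sum (I : Type) (r : seq I) (P : pred I) (F : I -> L) :
  f (\sum_(i <- r | P i) F i) = \sum_(i <- r | P i) f (F i).
Proof. exact: (big_morph f homD hom0). Qed.

Lemma hom_preim_subspace (S : set M) : is_subspace S -> is_subspace (f @^-1` S).
Proof.
move=> subS; split; rewrite /preimage /=; first by rewrite hom0; exact: subspace0.
by move=> a u v Su Sv; rewrite homD homZ; apply: subspaceD => //; exact: subspaceZ.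
Qed.

Lemma gamma_hom c u : gamma L c u -> gamma M c (f u).
Proof.
elim: c u => [//|[//|c] IHc]; apply: gamma_ind.
  by apply: hom_preim_subspace; exact: gamma_subspace.
by move=> u v /IHc fu /=; rewrite /preimage /= hom_lie -addn1; apply: gamma_lie.
Qed.

End Homomorphisms.

Section Derivations.
Variables (K : fieldType) (L : lieAlgType K).

Definition derivation (d : L -> L) : Prop :=
  linear d /\ forall u v, d [lie u, v] = [lie d u, v] + [lie u, d v].

Variable d : L -> L.
Hypothesis d_der : derivation d.

Lemma der_lie u v : d [lie u, v] = [lie d u, v] + [lie u, d v].
Proof. exact: d_der.2. Qed.

Lemma derD u v : d (u + v) = d u + d v.
Proof. by have := d_der.1 1 u v; rewrite !scale1r. Qed.

Lemma der0 : d 0 = 0.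
Proof. by apply: (addrI (d 0)); rewrite -derD !addr0. Qed.

Lemma derZ a u : d (a *: u) = a *: d u.
Proof. by have := d_der.1 a u 0; rewrite der0 !addr0. Qed.

End Derivations.

Section Subalgebra.
Variables (K : fieldType) (L : lieAlgType K).

(** A subalgebra is turned into a Lie algebra of its own, so that the universal
    property of a free Lie algebra applies to it. *)
Record subalgebra := Subalgebra {
  subalg_set :> set L;
  subalg_subspace : is_subspace subalg_set;
  subalg_lie : forall u v, subalg_set u -> subalg_set v -> subalg_set [lie u, v]
}.

Variable S : subalgebra.

Definition subalg_pred : pred L := fun u => `[< subalg_set S u >].

Fact subalg_pred_closed : submod_closed subalg_pred.
Proof.
split=> [|a u v]; first exact/asboolP/(subspace0 (subalg_subspace S)).
by move=> /asboolP Su /asboolP Sv; apply/asboolP/(subalg_subspace S).2.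
Qed.

HB.instance Definition _ := GRing.isSubmodClosed.Build K L subalg_pred
  subalg_pred_closed.

Definition subalg_type := {u : L | subalg_pred u}.

HB.instance Definition _ := SubType.on subalg_type.
HB.instance Definition _ := [Choice of subalg_type by <:].
HB.instance Definition _ := [SubChoice_isSubLmodule of subalg_type by <:].

Fact subalg_bracket_subproof (u v : subalg_type) :
  subalg_pred [lie val u, val v].
Proof.
apply/asboolP; apply: subalg_lie.
  exact/asboolP/(valP u).
exact/asboolP/(valP v).
Qed.

Definition subalg_bracket (u v : subalg_type) : subalg_type :=
  Sub _ (subalg_bracket_subproof u v).

Fact subalg_linearl (v : subalg_type) : linear (subalg_bracket^~ v).
Proof.
move=> a u w; apply: val_inj.
by rewrite !(linearP, SubK) /= lieDl lieZl.
Qed.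

Fact subalg_linearr (u : subalg_type) : linear (subalg_bracket u).
Proof.
move=> a v w; apply: val_inj.
by rewrite !(linearP, SubK) /= lieDr lieZr.
Qed.

Fact subalg_bracketxx (u : subalg_type) : subalg_bracket u u = 0.
Proof. by apply: val_inj; rewrite SubK bracketxx. Qed.

Fact subalg_jacobi (u v w : subalg_type) :
  subalg_bracket u (subalg_bracket v w) + subalg_bracket v (subalg_bracket w u)
    + subalg_bracket w (subalg_bracket u v) = 0.
Proof. by apply: val_inj; rewrite /= jacobi. Qed.

HB.instance Definition _ := Lmodule_isLieAlgebra.Build K subalg_type
  subalg_linearl subalg_linearr subalg_bracketxx subalg_jacobi.

End Subalgebra.

Section Free.
Variables (K : fieldType) (n : nat) (L : lieAlgType K) (x : 'I_n -> L).
Hypothesis freeL : free_on x.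

Lemma free_hom (M : lieAlgType K) (m : 'I_n -> M) :
  exists f : L -> M, lie_hom f /\ forall i, f (x i) = m i.
Proof. by have [f [fP _]] := freeL m; exists f. Qed.

Lemma free_hom_inj (M : lieAlgType K) (f g : L -> M) : lie_hom f -> lie_hom g ->
  (forall i, f (x i) = g (x i)) -> f = g.
Proof.
move=> fh gh fg; have [h [_ uniq_h]] := freeL (f \o x).
have -> : f = h by rewrite (uniq_h f).
by rewrite (uniq_h g) //; split=> // i; rewrite -fg.
Qed.

(** The homomorphism that sends each generator to itself, seen in the
    subalgebra S, is followed by the inclusion of S; the composite fixes the
    generators, so it is the identity. *)
Lemma free_ind (S : set L) : is_subspace S ->
  (forall u v, S u -> S v -> S [lie u, v]) -> (forall i, S (x i)) ->
  forall u, S u.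
Proof.
move=> subS lieS xS u; pose T := Subalgebra subS lieS.
have xT i : subalg_pred T (x i) by exact/asboolP/xS.
have [f [fh fx]] := free_hom (fun i => Sub (x i) (xT i) : subalg_type T).
have -> : u = val (f u).
  have /(congr1 (@^~ u)) // : id = val \o f.
  apply: free_hom_inj => // [|i /=]; last by rewrite fx SubK.
  by split=> [a v w|v w] /=; rewrite ?(homD fh, homZ fh, hom_lie fh) // linearP.
exact/asboolP/(valP (f u)).
Qed.

End Free.
(** * The variety of the presented algebra *)

(** The two laws say that N' is nilpotent of class 2 and that the third term
    of the lower central series is abelian. *)
Definition variety_laws (K : fieldType) (N : lieAlgType K) : Prop :=
  (forall u v w : N, gamma N 2 u -> gamma N 2 v -> gamma N 2 w ->
    [lie u, v, w] = 0) /\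
  (forall u v : N, gamma N 3 u -> gamma N 3 v -> [lie u, v] = 0).

Section DualNumbers.
Variables (K : fieldType) (R : lieAlgType K).

(** The Lie algebra of the u.1 + u.2 e with e ^ 2 = 0: a homomorphism into it
    whose first component is the identity has a derivation as its second
    component. *)
Definition dual : Type := (R * R)%type.

HB.instance Definition _ := GRing.Lmodule.copy dual (R * R)%type.

Definition dual_bracket (u v : dual) : dual :=
  ([lie u.1, v.1], [lie u.1, v.2] + [lie u.2, v.1]).

Fact dual_linearl (v : dual) : linear (dual_bracket^~ v).
Proof.
move=> a u w; congr pair; first by rewrite /= lieDl lieZl.
by rewrite /= !lieDl !lieZl scalerDr addrACA.
Qed.

Fact dual_linearr (u : dual) : linear (dual_bracket u).
Proof.
move=> a v w; congr pair; first by rewrite /= lieDr lieZr.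
by rewrite /= !lieDr !lieZr scalerDr addrACA.
Qed.

Fact dual_bracketxx (u : dual) : dual_bracket u u = 0.
Proof.
by congr pair; rewrite /= ?bracketxx // [in X in _ + X]lieC subrr.
Qed.

Fact dual_jacobi (u v w : dual) :
  dual_bracket u (dual_bracket v w) + dual_bracket v (dual_bracket w u)
    + dual_bracket w (dual_bracket u v) = 0.
Proof.
congr pair; first by rewrite /= jacobi.
rewrite /= !lieDr (AC (3*3*3) ((1*5*9)*(2*6*7)*(3*4*8)))/=.
by rewrite !jacobi !addr0.
Qed.

HB.instance Definition _ := Lmodule_isLieAlgebra.Build K dual
  dual_linearl dual_linearr dual_bracketxx dual_jacobi.
End DualNumbers.

Section DualLaws.
Variables (K : fieldType) (R : lieAlgType K).

Lemma gamma_dual c (u : dual R) :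
  gamma (dual R) c u -> gamma R c u.1 /\ gamma R c u.2.
Proof.
elim: c u => [//|[//|c] IHc]; apply: gamma_ind.
  split=> [|a u v [u1 u2] [v1 v2]]; first by split; exact: gamma0.
  by split; apply: gammaD => //; exact: gammaZ.
move=> u v /IHc[u1 u2]; rewrite -addn1; split=> /=.
  exact: gamma_lie.
by apply: gammaD; exact: gamma_lie.
Qed.

Lemma dual_laws : variety_laws R -> variety_laws (dual R).
Proof.
move=> [law2 law3]; split=> [u v w|u v].
  move=> /gamma_dual[u1 u2] /gamma_dual[v1 v2] /gamma_dual[w1 w2].
  by congr pair; rewrite /= ?lieDl !law2 ?addr0.
move=> /gamma_dual[u1 u2] /gamma_dual[v1 v2].
by congr pair; rewrite /= !law3 ?addr0.
Qed.

End DualLaws.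

Section Presentation.
Variables (K : fieldType) (n : nat) (L : lieAlgType K) (x : 'I_n -> L).
Hypothesis freeL : free_on x.
Variables (R : lieAlgType K) (pi : L -> R).
Hypothesis quotR : is_quotient (relation_ideal L) pi.

Local Notation y := (fun i => pi (x i)).

Let pi_hom : lie_hom pi. Proof. by have [] := quotR. Qed.

Lemma quotient_surj r : exists u, pi u = r.
Proof. by have [_ /(_ r)] := quotR. Qed.

Lemma gamma_lift c r : gamma R c r -> exists2 u, gamma L c u & pi u = r.
Proof.
elim: c r => [|[|c] IHc] r.
- by have [u <-] := quotient_surj r; exists u.
- by have [u <-] := quotient_surj r; exists u.
apply: (gamma_ind (S := fun r => exists2 u, gamma L c.+2 u & pi u = r)).
  split=> [|a _ _ [u cu <-] [v cv <-]].
    by exists 0; [exact: gamma0|exact: hom0].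
  exists (a *: u + v); last by rewrite (homD pi_hom) (homZ pi_hom).
  by apply: gammaD => //; exact: gammaZ.
move=> r1 r2 /IHc[u cu <-]; have [v <-] := quotient_surj r2.
exists [lie u, v]; last by rewrite (hom_lie pi_hom).
by rewrite -addn1; exact: gamma_lie.
Qed.

Lemma quotient_laws : variety_laws R.
Proof.
have ker_pi u : relation_ideal L u -> pi u = 0 by have [_ _ /(_ u)[]] := quotR.
split=> [_ _ _ /gamma_lift[u gu <-] /gamma_lift[v gv <-] /gamma_lift[w gw <-]|].
  rewrite -!(hom_lie pi_hom); apply: ker_pi; exists [lie u, v, w].
    by apply: lie_prod_lie => //; exact: lie_prod_lie.
  by exists 0; rewrite ?addr0 //; exact: subspace0 (lin_span_subspace _).
move=> _ _ /gamma_lift[u gu <-] /gamma_lift[v gv <-].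
rewrite -(hom_lie pi_hom); apply: ker_pi; exists 0.
  exact: subspace0 (lin_span_subspace _).
by exists [lie u, v]; rewrite ?add0r //; exact: lie_prod_lie.
Qed.

Lemma laws_kill_relations (N : lieAlgType K) (f : L -> N) u : variety_laws N ->
  lie_hom f -> relation_ideal L u -> f u = 0.
Proof.
move=> [law2 law3] fh [v v_in [w w_in <-]]; rewrite (homD fh).
have ker_subspace : is_subspace [set z : L | f z = 0].
  split=> [|a z t /= fz ft]; first exact: hom0.
  by rewrite (homD fh) (homZ fh) fz ft scaler0 addr0.
suff [-> ->] : f v = 0 /\ f w = 0 by rewrite addr0.
split; last first.
  apply: (lin_span_sub ker_subspace _ w_in) => _ [z gz [t gt <-]] /=.
  by rewrite (hom_lie fh) law3 //; exact: gamma_hom.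
apply: (lin_span_sub ker_subspace _ v_in) => _ [z z_in [t gt <-]] /=.
pose S := [set z : L | forall s, gamma N 2 s -> [lie f z, s] = 0].
suff Sz : S z by rewrite (hom_lie fh); apply: Sz; exact: gamma_hom.
apply: (lin_span_sub _ _ z_in).
  split=> [s _|a p q Sp Sq s gs]; first by rewrite (hom0 fh) lie0l.
  by rewrite (homD fh) (homZ fh) lieDl lieZl Sp // Sq // scaler0 addr0.
move=> _ [p gp [q gq <-]] s gs; rewrite (hom_lie fh).
by apply: law2 => //; exact: gamma_hom.
Qed.

(** R is relatively free: the defining relations of R vanish in every Lie algebra
    that satisfies the laws, so homomorphisms from L descend. *)
Lemma quotient_hom (N : lieAlgType K) (m : 'I_n -> N) : variety_laws N ->
  exists f : R -> N, lie_hom f /\ forall i, f (y i) = m i.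
Proof.
move=> lawN; have [f [fh fx]] := free_hom freeL m.
have [s sK] := choice quotient_surj.
have f_pi u : f (s (pi u)) = f u.
  apply/eqP; rewrite -subr_eq0 -(homB fh); apply/eqP.
  apply: laws_kill_relations => //; have [_ _ ker_pi] := quotR.
  by apply: (ker_pi _).1; rewrite (homB pi_hom) sK subrr.
exists (f \o s); split=> [|i] /=; last by rewrite f_pi.
split=> [a r1 r2|r1 r2] /=; rewrite -{1}(sK r1) -{1}(sK r2).
  by rewrite -(homZ pi_hom) -(homD pi_hom) f_pi (homD fh) (homZ fh).
by rewrite -(hom_lie pi_hom) f_pi (hom_lie fh).
Qed.

Lemma quotient_ind (S : set R) : is_subspace S ->
  (forall u v, S u -> S v -> S [lie u, v]) -> (forall i, S (y i)) ->
  forall r, S r.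
Proof.
move=> subS lieS yS r; have [u <-] := quotient_surj r.
apply: (free_ind freeL (S := pi @^-1` S)) => //.
  exact: hom_preim_subspace.
by move=> v w Sv Sw; rewrite /preimage /= (hom_lie pi_hom); exact: lieS.
Qed.

Lemma quotient_hom_inj (N : lieAlgType K) (f g : R -> N) : lie_hom f ->
  lie_hom g -> (forall i, f (y i) = g (y i)) -> f =1 g.
Proof.
move=> fh gh fg; apply: (quotient_ind (S := [set r | f r = g r])) => //.
  split=> [|a u v /= fgu fgv]; first by rewrite /= (hom0 fh) (hom0 gh).
  by rewrite (homD fh) (homD gh) (homZ fh) (homZ gh) fgu fgv.
by move=> u v /= fgu fgv; rewrite (hom_lie fh) (hom_lie gh) fgu fgv.
Qed.

(** Derivations of R are the homomorphisms into the dual numbers over R that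
    lift the identity. *)
Lemma quotient_derivation (m : 'I_n -> R) :
  exists d : R -> R, derivation d /\ forall i, d (y i) = m i.
Proof.
have [f [fh fy]] := quotient_hom (fun i => (y i, m i) : dual R)
  (dual_laws quotient_laws).
have f1 : fst \o f =1 id.
  apply: quotient_hom_inj => // [|i /=]; last by rewrite fy.
  split=> [a u v|u v] /=; first by rewrite (homD fh) (homZ fh).
  by rewrite (hom_lie fh).
exists (snd \o f); split=> [|i /=]; last by rewrite fy.
split=> [a u v|u v] /=; first by rewrite (homD fh) (homZ fh).
have [/= fu fv] := (f1 u, f1 v).
by rewrite (hom_lie fh) /= fu fv addrC.
Qed.

(** * Tame automorphisms *)

(** The relations of R form a fully invariant ideal of L, so automorphisms of L
    descend to R. *)
Lemma tame_of_free (f g : L -> L) : lie_hom f -> lie_hom g ->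
  (forall i, f (g (x i)) = x i) -> (forall i, g (f (x i)) = x i) ->
  exists phi : lieAut R, [/\ tame pi phi, forall u, phi (pi u) = pi (f u)
    & forall u, aut_inv phi (pi u) = pi (g u)].
Proof.
move=> fh gh fg gf.
have comp_hom (N1 N2 N3 : lieAlgType K) (h : N1 -> N2) (k : N2 -> N3) :
  lie_hom h -> lie_hom k -> lie_hom (k \o h).
  move=> hh kh; split=> [a u v|u v] /=.
    by rewrite (homD hh) (homZ hh) (homD kh) (homZ kh).
  by rewrite (hom_lie hh) (hom_lie kh).
have fgK : cancel f g.
  move=> u; have /(congr1 (@^~ u)) // : g \o f = id.
  by apply: (free_hom_inj freeL) => //; exact: comp_hom.
have gfK : cancel g f.
  move=> u; have /(congr1 (@^~ u)) // : f \o g = id.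
  by apply: (free_hom_inj freeL) => //; exact: comp_hom.
have descend (h : L -> L) : lie_hom h ->
    exists2 h' : R -> R, lie_hom h' & forall u, h' (pi u) = pi (h u).
  move=> hh; have [h' [h'h h'y]] :=
    quotient_hom (fun i => pi (h (x i))) quotient_laws.
  exists h' => // u; have /(congr1 (@^~ u)) // : h' \o pi = pi \o h.
  by apply: (free_hom_inj freeL) => //; exact: comp_hom.
have [[f' f'h f'pi] [g' g'h g'pi]] := (descend f fh, descend g gh).
have f'K : cancel f' g'.
  by move=> r; have [u <-] := quotient_surj r; rewrite f'pi g'pi fgK.
have g'K : cancel g' f'.
  by move=> r; have [u <-] := quotient_surj r; rewrite g'pi f'pi gfK.
exists (LieAut f'h f'K g'K); split=> //.
by exists (LieAut fh fgK gfK).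
Qed.

(** A stand-in for the subalgebra of R generated by the y_i with i different
    from j: all that matters is that some representative in L is fixed by the
    endomorphisms that only move x_j. *)
Definition avoids (j : 'I_n) : set R :=
  [set r | exists2 u, pi u = r & forall f : L -> L, lie_hom f ->
    (forall i, i != j -> f (x i) = x i) -> f u = u].

Lemma avoids_gen i j : i != j -> avoids j (y i).
Proof. by move=> ij; exists (x i) => // f _; apply. Qed.

Lemma avoids_lie j r s : avoids j r -> avoids j s -> avoids j [lie r, s].
Proof.
move=> [u <- fu] [v <- fv]; exists [lie u, v]; first exact: (hom_lie pi_hom).
by move=> f fh fx; rewrite (hom_lie fh) fu // fv.
Qed.

Lemma avoidsZ j a r : avoids j r -> avoids j (a *: r).
Proof.
move=> [u <- fu]; exists (a *: u); first exact: (homZ pi_hom).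
by move=> f fh fx; rewrite (homZ fh) fu.
Qed.

(** x_j |-> x_j + u and x_j |-> x_j - u are mutually inverse because both fix
    u. *)
Lemma tame_elementary j r : avoids j r ->
  exists phi : lieAut R, [/\ tame pi phi, phi (y j) = y j + r,
    aut_inv phi (y j) = y j - r,
    forall i, i != j -> phi (y i) = y i
    & forall i, i != j -> aut_inv phi (y i) = y i].
Proof.
move=> [u <- fu].
have elem (v : L) : exists f : L -> L, [/\ lie_hom f, f (x j) = x j + v
    & forall i, i != j -> f (x i) = x i].
  have [f [fh fx]] := free_hom freeL (fun i => if i == j then x i + v else x i).
  by exists f; split=> // [|i /negPf]; rewrite fx ?eqxx // => ->.
have [[f [fh fj fi]] [g [gh gj gi]]] := (elem u, elem (- u)).
have [||phi [phi_tame phi_pi phi_inv]] := @tame_of_free f g fh gh.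
- move=> i; have [->|/[dup] ij /gi ->] := eqVneq i j; last exact: fi.
  by rewrite gj (homB fh) fj (fu f) // addrK.
- move=> i; have [->|/[dup] ij /fi ->] := eqVneq i j; last exact: gi.
  by rewrite fj (homD gh) gj (fu g) // subrK.
exists phi; split=> // [||i ij|i ij]; rewrite ?phi_pi ?phi_inv.
- by rewrite fj (homD pi_hom).
- by rewrite gj (homB pi_hom).
- by rewrite fi.
- by rewrite gi.
Qed.

Lemma tame_linear (A : 'M[K]_n) : A \in unitmx ->
  exists phi : lieAut R, [/\ tame pi phi,
    forall i, phi (y i) = \sum_j A i j *: y j
    & forall i, aut_inv phi (y i) = \sum_j invmx A i j *: y j].
Proof.
move=> unitA.
have lin (B : 'M[K]_n) := free_hom freeL (fun i => \sum_j B i j *: x j).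
have pi_lin (B : 'M_n) i : pi (\sum_j B i j *: x j) = \sum_j B i j *: y j.
  by rewrite (hom_sum pi_hom); apply: eq_bigr => j _; rewrite (homZ pi_hom).
have linM (B C : 'M_n) (f g : L -> L) i : lie_hom f ->
    (forall i, f (x i) = \sum_j B i j *: x j) ->
    (forall i, g (x i) = \sum_j C i j *: x j) ->
    C *m B = 1%:M -> f (g (x i)) = x i.
  move=> fh fx gx CB; rewrite gx (hom_sum fh).
  under eq_bigr => j _ do rewrite (homZ fh) fx scaler_sumr.
  rewrite exchange_big /=.
  under eq_bigr => k _ do [under eq_bigr => j _ do rewrite scalerA;
    rewrite -scaler_suml].
  rewrite (bigD1 i) //= [X in _ + X]big1 ?addr0 => [|k ki].
    have /matrixP/(_ i i) := CB; rewrite !mxE eqxx => ->.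
    by rewrite scale1r.
  have /matrixP/(_ i k) := CB; rewrite !mxE eq_sym (negPf ki) => ->.
  by rewrite scale0r.
have [[f [fh fx]] [g [gh gx]]] := (lin A, lin (invmx A)).
have [||phi [phi_tame phi_pi phi_inv]] := @tame_of_free f g fh gh.
- by move=> i; apply: linM fh fx gx _; rewrite mulVmx.
- by move=> i; apply: linM gh gx fx _; rewrite mulmxV.
by exists phi; split=> // i; rewrite ?phi_pi ?phi_inv ?fx ?gx pi_lin.
Qed.

End Presentation.
(** * Coefficients of polynomial curves *)

Lemma natr_eq0_char0 (K : fieldType) (charK0 : [pchar K] =i pred0) k :
  (k%:R == 0 :> K) = (k == 0)%N.
Proof. exact: (pcharf0P K).1. Qed.

(** Replacing t by 2 t and subtracting 2 ^ N times the curve kills the top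
    coefficient and multiplies the coefficient of t ^ m by 2 ^ m - 2 ^ N, a
    nonzero integer. *)
Lemma curve_coef (K : fieldType) (charK0 : [pchar K] =i pred0)
    (V : lmodType K) (P : V -> Prop) (N : nat) (F : nat -> V) :
  (forall u v, P u -> P v -> P (u - v)) ->
  (forall u k, (0 < k)%N -> P (u *+ k) -> P u) ->
  (forall t, P (\sum_(m < N) t%:R ^+ m *: F m)) ->
  forall m, (m < N)%N -> P (F m).
Proof.
move=> PB Pdiv; have P0 u : P u -> P 0 by move=> Pu; rewrite -(subrr u); exact: PB.
have PN u : P u -> P (- u).
  by move=> Pu; rewrite -sub0r; apply: PB => //; exact: P0 Pu.
have PD u v : P u -> P v -> P (u + v).
  by move=> Pu /PN Pv; rewrite -[v]opprK; exact: PB.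
have PM u k : P u -> P (u *+ k).
  move=> Pu; elim: k => [|k IHk]; first by rewrite mulr0n; exact: P0 Pu.
  by rewrite mulrS; exact: PD.
elim: N F => [//|N IHN] F PF.
have lowF m : (m < N)%N -> P (F m).
  move=> ltmN; have lt2 : (0 < 2 ^ N - 2 ^ m)%N by rewrite subn_gt0 ltn_exp2l.
  apply: (Pdiv _ _ lt2); rewrite -[_ *+ _]opprK; apply: PN.
  rewrite -mulNrn -scaler_nat scalerN -scaleNr.
  pose G k := - (2 ^ N - 2 ^ k)%:R *: F k; rewrite -[_ *: _]/(G m).
  apply: (IHN G) => // t.
  rewrite (_ : \sum_(k < N) _ = \sum_(k < N.+1) (t * 2)%:R ^+ k *: F k
      - (\sum_(k < N.+1) t%:R ^+ k *: F k) *+ 2 ^ N); first by apply/PB/PM.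
  rewrite -scaler_nat scaler_sumr -sumrB big_ord_recr /=.
  rewrite scalerA natrM exprMn natrX [X in _ - X *: _]mulrC.
  rewrite subrr addr0; apply: eq_bigr => k _.
  rewrite /G exprMn !scalerA -scalerBl natrB ?leq_exp2l ?(ltnW (ltn_ord k)) //.
  by congr (_ *: _); rewrite !natrX mulrN mulrBr opprB [_ * _ ^+ N]mulrC.
move=> m; rewrite ltnS leq_eqVlt => /orP[/eqP ->|]; last exact: lowF.
have := PF 1%N; rewrite big_ord_recr /= expr1n scale1r.
set S := \sum_(_ < _) _ => PS; rewrite -[F N](addKr S) addrC; apply: PB => //.
rewrite {}/S in PS *; apply: big_ind => [|u v|k _]; [exact: P0 PS|exact: PD|].
by rewrite expr1n scale1r; apply: lowF.
Qed.

Section Horner.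
Variables (K : fieldType).

(** The curve t |-> s_0 + t s_1 + t ^ 2 s_2 + ... in Horner form, which makes
    the closure under brackets a plain induction. *)
Definition curve (V : lmodType K) (s : seq V) (t : K) : V :=
  foldr (fun c w => c + t *: w) 0 s.

Lemma curveE (V : lmodType K) (s : seq V) t :
  curve s t = \sum_(m < size s) t ^+ m *: s`_m.
Proof.
elim: s => [|c s IHs] /=; first by rewrite big_ord0.
rewrite big_ord_recl expr0 scale1r IHs scaler_sumr; congr (_ + _).
by apply: eq_bigr => m _; rewrite scalerA -exprS.
Qed.

Lemma curve_add (V : lmodType K) (s1 s2 : seq V) :
  exists s, forall t, curve s t = curve s1 t + curve s2 t.
Proof.
elim: s1 s2 => [|c1 s1 IHs] [|c2 s2].
- by exists [::] => t; rewrite addr0.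
- by exists (c2 :: s2) => t; rewrite add0r.
- by exists (c1 :: s1) => t; rewrite addr0.
have [s sE] := IHs s2; exists (c1 + c2 :: s) => t /=.
by rewrite sE scalerDr addrACA.
Qed.

Lemma curve_lie (R : lieAlgType K) (s1 s2 : seq R) :
  exists s, forall t, curve s t = [lie curve s1 t, curve s2 t].
Proof.
elim: s1 => [|c1 s1 [s sE]]; first by exists [::] => t; rewrite lie0l.
have [s' s'E] := curve_add [seq [lie c1, c] | c <- s2] (0 :: s).
exists s' => t; rewrite s'E /= lieDl lieZl sE add0r; congr (_ + _).
elim: s2 {s sE s' s'E} => [|c s2 IHs]; first by rewrite lie0r.
by rewrite /= lieDr lieZr IHs.
Qed.

End Horner.

(** * Leading terms of automorphisms *)

Section Filtration.
Variables (K : fieldType) (n : nat) (R : lieAlgType K) (y : 'I_n -> R).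

Hypothesis genR : forall S : set R, is_subspace S ->
  (forall u v, S u -> S v -> S [lie u, v]) -> (forall i, S (y i)) ->
  forall r, S r.

Lemma linear_part r : exists a : 'I_n -> K, gamma R 2 (r - \sum_i a i *: y i).
Proof.
move: r; apply: genR => [|u v _ _|i].
- split=> [|k u v [a ua] [b vb]].
    by exists (fun=> 0); rewrite big1 ?subr0 => [|i _]; rewrite ?scale0r //; exact: gamma0.
  exists (fun i => k * a i + b i).
  rewrite (_ : _ - _ = k *: (u - \sum_i a i *: y i) + (v - \sum_i b i *: y i)).
    by apply: gammaD => //; exact: gammaZ.
  rewrite scalerBr addrACA -opprD scaler_sumr -big_split /=; congr (_ - _).
  by apply: eq_bigr => i _; rewrite scalerDl scalerA.
- exists (fun=> 0); rewrite big1 ?subr0 => [|i _]; last by rewrite scale0r.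
  exact: gamma2_lie.
- exists (fun j => (j == i)%:R); rewrite (bigD1 i) //= eqxx scale1r big1 => [|j /negPf ->].
    by rewrite addr0 subrr; exact: gamma0.
  by rewrite scale0r.
Qed.

(** f - g is a derivation along f and g, so it raises the weight by c - 1 as soon
    as it does so on the generators. *)
Lemma hom_diff c (f g : R -> R) : lie_hom f -> lie_hom g ->
    (forall i, gamma R c (f (y i) - g (y i))) ->
  forall d r, gamma R d.+1 r -> gamma R (c + d) (f r - g r).
Proof.
move=> fh gh fgy.
have lie_diff u v : f [lie u, v] - g [lie u, v] =
    [lie f u - g u, f v] + [lie g u, f v - g v].
  by rewrite (hom_lie fh) (hom_lie gh) lieBl lieBr; zmodule.
have diff_subspace e : is_subspace [set r | gamma R e (f r - g r)].
  split=> [|a u v /= fgu fgv]; first by rewrite /= (hom0 fh) (hom0 gh) subrr; exact: gamma0.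
  rewrite (homD fh) (homD gh) (homZ fh) (homZ gh) opprD addrACA -scalerBr.
  by apply: gammaD => //; exact: gammaZ.
have base r : gamma R c (f r - g r).
  move: r; apply: (genR (diff_subspace c)) => // u v /= fgu fgv.
  rewrite lie_diff; apply: (@gamma_le _ _ _ c.+1) => //; apply: gammaD.
    by rewrite -addn1; exact: gamma_lie.
  by rewrite -add1n; exact: gamma_lie.
elim=> [r _|d IHd]; first by rewrite addn0.
apply: (gamma_ind (diff_subspace _)) => u v du /=; rewrite lie_diff.
apply: gammaD; first by rewrite addnS -addn1; apply: gamma_lie => //; exact: IHd.
by rewrite addnC; apply: gamma_lie; [exact: (gamma_hom gh)|].
Qed.

Lemma der_gamma c (d : R -> R) : derivation d ->
    (forall i, gamma R c (d (y i))) ->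
  forall e r, gamma R e.+1 r -> gamma R (c + e) (d r).
Proof.
move=> dd dy.
have der_subspace e : is_subspace [set r | gamma R e (d r)].
  split=> [|a u v /= fgu fgv]; first by rewrite /= (der0 dd); exact: gamma0.
  by rewrite (derD dd) (derZ dd); apply: gammaD => //; exact: gammaZ.
have base r : gamma R c (d r).
  move: r; apply: (genR (der_subspace c)) => // u v /= du dv.
  rewrite (der_lie dd); apply: (@gamma_le _ _ _ c.+1) => //; apply: gammaD.
    by rewrite -addn1; exact: gamma_lie.
  by rewrite -add1n; exact: gamma_lie.
elim=> [r _|e IHe]; first by rewrite addn0.
apply: (gamma_ind (der_subspace _)) => u v eu /=; rewrite (der_lie dd).
apply: gammaD; first by rewrite addnS -addn1; apply: gamma_lie => //; exact: IHe.
by rewrite addnC; exact: gamma_lie.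
Qed.

(** To first order, an automorphism y_i |-> y_i + u_i + (terms of higher weight)
    acts as the identity plus the derivation y_i |-> u_i: the error in the
    Leibniz rule is a product of two increments, of weight at least 2 c. *)
Lemma hom_derivation c (f d : R -> R) : (1 < c)%N -> lie_hom f ->
    derivation d -> (forall i, gamma R c (d (y i))) ->
    (forall i, gamma R c.+1 (f (y i) - y i - d (y i))) ->
  forall e r, gamma R e.+1 r -> gamma R (c + e).+1 (f r - r - d r).
Proof.
move=> c_gt1 fh dd dy fdy; pose D r := f r - r - d r.
have DE u v : D [lie u, v] =
    [lie D u, v] + [lie u, D v] + [lie f u - u, f v - v].
  by rewrite /D (hom_lie fh) (der_lie dd) !(lieBl, lieBr); zmodule.
have fy i : gamma R c (f (y i) - y i).
  rewrite -[_ - _](subrK (d (y i))); apply: gammaD => //.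
  exact: gamma_le (leqnSn _) (fdy i).
have f_diff e r : gamma R e.+1 r -> gamma R (c + e) (f r - r).
  exact: hom_diff.
have D_subspace e : is_subspace [set r | gamma R e (D r)].
  split=> [|a u v /= Du Dv].
    by rewrite /D /= (hom0 fh) (der0 dd) !subr0; exact: gamma0.
  rewrite (_ : D _ = a *: D u + D v); first by apply: gammaD => //; exact: gammaZ.
  by rewrite /D (homD fh) (homZ fh) (derD dd) (derZ dd) !scalerBr; zmodule.
have base r : gamma R c.+1 (D r).
  move: r; apply: (genR (D_subspace _)) => // u v /= Du Dv; rewrite DE.
  apply: gammaD; first apply: gammaD.
  - by apply: (@gamma_le _ _ _ c.+2) => //; rewrite -addn1; exact: gamma_lie.
  - by apply: (@gamma_le _ _ _ c.+2) => //; rewrite -add1n; exact: gamma_lie.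
  apply: (@gamma_le _ _ _ (c + c)); first by rewrite -addn1 leq_add2l ltnW.
  by apply: gamma_lie; rewrite -[X in gamma R X _]addn0; exact: f_diff.
elim=> [r _|e IHe]; first by rewrite addn0; exact: base.
apply: (gamma_ind (D_subspace _)) => u v eu /=; rewrite DE; apply: gammaD; first apply: gammaD.
- by rewrite addnS -addn1; apply: gamma_lie => //; exact: IHe.
- by rewrite [(c + _)%N]addnC -addnS; apply: gamma_lie => //; exact: base.
apply: (@gamma_le _ _ _ (c + e + c)).
  by rewrite addnS -addn2 leq_add2l.
by apply: gamma_lie; [exact: f_diff|rewrite -[X in gamma R X _]addn0; exact: f_diff].
Qed.

Definition single (i : 'I_n) (f : R) : 'I_n -> R :=
  fun k => if k == i then f else 0.

Lemma gamma_single c i f k : gamma R c f -> gamma R c (single i f k).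
Proof. by rewrite /single; case: eqP => // *; exact: gamma0. Qed.

Variable H : set (lieAut R).
Hypothesis H1 : H 1%g.
Hypothesis HM : forall g h, H g -> H h -> H (g * h)%g.
Hypothesis HV : forall g, H g -> H (g^-1)%g.

(** Two tuples that agree modulo weight c + 1 represent the same leading term. *)
Definition leading (c : nat) (u : 'I_n -> R) : Prop :=
  (forall i, gamma R c (u i)) /\
  exists2 h, H h & forall i, gamma R c.+1 (h (y i) - y i - u i).

Lemma leading_congr c u v : leading c u ->
  (forall i, gamma R c.+1 (v i - u i)) -> leading c v.
Proof.
move=> [cu [h Hh hu]] uv; split=> [i|].
  rewrite -(subrK (u i) (v i)); apply: gammaD => //.
  exact: gamma_le (leqnSn _) (uv i).
exists h => // i; rewrite (_ : _ - v i = (h (y i) - y i - u i) - (v i - u i)).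
  exact: gammaB.
by zmodule.
Qed.

Lemma leading_deep c u : (forall i, gamma R c.+1 (u i)) -> leading c u.
Proof.
move=> cu; apply: (@leading_congr c 0) => [|i]; last by rewrite subr0.
split=> [i|]; first exact: gamma0.
by exists 1%g => // i; rewrite subrr subr0; exact: gamma0.
Qed.

Lemma leading_ext c u v : leading c u -> u =1 v -> leading c v.
Proof.
by move=> cu uv; apply: leading_congr cu _ => i; rewrite uv subrr; exact: gamma0.
Qed.

(** Comparing h1 and h2 on the generators y_i amounts to comparing h1 / h2 with
    the identity on the generators h2 y_i, which differ from the y_i by elements
    of weight 2. *)
Lemma leading_quotient c u h1 h2 : H h1 -> H h2 ->
  (forall i, gamma R 2 (h2 (y i) - y i)) -> (forall i, gamma R c (u i)) ->
  (forall i, gamma R c.+1 (h1 (y i) - h2 (y i) - u i)) -> leading c u.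
Proof.
move=> Hh1 Hh2 h2y cu h12; split=> //; exists (h1 * h2^-1)%g.
  by apply: HM => //; exact: HV.
move=> i /=; set s := aut_inv h2 (y i).
have s_y : gamma R 2 (s - y i).
  rewrite -[X in _ - X](aut_funK h2 (y i)) -(homB (lie_hom_inv h2)).
  by apply: (gamma_hom (lie_hom_inv h2)); rewrite -opprB; exact: gammaN.
rewrite -{1}(aut_invK h2 (y i)) -/s.
rewrite (_ : _ - u i = (h1 (y i) - h2 (y i) - u i)
    + (h1 (s - y i) - h2 (s - y i))).
  apply: gammaD => //; rewrite -addn1.
  apply: (hom_diff (aut_hom h1) (aut_hom h2)) => // j.
  rewrite -[_ - _](subrK (u j)); apply: gammaD => //.
  exact: gamma_le (leqnSn _) (h12 j).
by rewrite (homB (aut_hom h1)) (homB (aut_hom h2)); zmodule.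
Qed.

Variable c : nat.
Hypothesis c_gt1 : (1 < c)%N.

Lemma leading_increment u h i : (forall j, gamma R c (u j)) ->
  gamma R c.+1 (h (y i) - y i - u i) -> gamma R c (h (y i) - y i).
Proof.
move=> cu hu; rewrite -[_ - _](subrK (u i)); apply: gammaD => //.
exact: gamma_le (leqnSn _) hu.
Qed.

Lemma leadingD u v : leading c u -> leading c v -> leading c (u + v).
Proof.
move=> [cu [g Hg gu]] [cv [h Hh hv]]; split=> [i|]; first exact: gammaD.
exists (g * h)%g => [|i]; first exact: HM.
rewrite (_ : _ - (u + v) i = (g (y i) - y i - u i) + (g (v i) - v i)
    + g (h (y i) - y i - v i)).
  apply: gammaD; last exact: (gamma_hom (aut_hom g)).
  apply: gammaD => //; apply: (@gamma_le _ _ _ (c + c.-1)).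
    by rewrite -addn1 leq_add2l -ltnS prednK // ltnW.
  apply: (hom_diff (aut_hom g) (@lie_hom_id _ _)) => [j|].
    exact: leading_increment.
  by rewrite prednK // ltnW.
by rewrite !(homB (aut_hom g)) -[(u + v) i]/(u i + v i); zmodule.
Qed.

Lemma leadingN u : leading c u -> leading c (- u).
Proof.
move=> [cu [h Hh hu]]; apply: (@leading_quotient c (- u) 1%g h) => // i.
- by apply: (gamma_le c_gt1); exact: leading_increment.
- exact: gammaN.
rewrite (_ : _ - _ = - (h (y i) - y i - u i)); first exact: gammaN.
by rewrite -[(- u) i]/(- u i) /=; zmodule.
Qed.

Lemma leadingB u v : leading c u -> leading c v -> leading c (u - v).
Proof. by move=> cu /leadingN; exact: leadingD. Qed.

Lemma leadingMn u k : leading c u -> leading c (u *+ k).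
Proof.
move=> cu; elim: k => [|k IHk]; last by rewrite mulrS; exact: leadingD.
by rewrite mulr0n; apply: leading_deep => i; exact: gamma0.
Qed.

Lemma leading_conj (g : lieAut R) (B : 'I_n -> 'I_n -> K) u : H g ->
    (forall i, aut_inv g (y i) = \sum_j B i j *: y j) ->
  leading c u -> leading c (fun i => \sum_j B i j *: g (u j)).
Proof.
move=> Hg gB [cu [h Hh hu]]; split=> [i|].
  by apply: gamma_sum => j _; apply: gammaZ; exact: (gamma_hom (aut_hom g)).
exists (g * h * g^-1)%g => [|i /=]; first by apply: HM; [exact: HM|exact: HV].
have gy : y i = \sum_j B i j *: g (y j).
  rewrite -{1}(aut_invK g (y i)) gB (hom_sum (aut_hom g)).
  by apply: eq_bigr => j _; rewrite (homZ (aut_hom g)).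
rewrite gB [in X in _ - X - _]gy (hom_sum (aut_hom h)) (hom_sum (aut_hom g)).
rewrite -!sumrB; apply: gamma_sum => j _.
rewrite (homZ (aut_hom h)) (homZ (aut_hom g)) -!scalerBr -!(homB (aut_hom g)).
by apply: gammaZ; exact: (gamma_hom (aut_hom g)).
Qed.

Hypothesis charK0 : [pchar K] =i pred0.
Hypothesis H_linear : forall A : 'M[K]_n, A \in unitmx ->
  exists phi : lieAut R, [/\ H phi, forall i, phi (y i) = \sum_j A i j *: y j
    & forall i, aut_inv phi (y i) = \sum_j invmx A i j *: y j].

Lemma scaling_gamma (g : R -> R) a e r : lie_hom g ->
    (forall i, g (y i) = a *: y i) ->
  gamma R e.+1 r -> gamma R e.+2 (g r - a ^+ e.+1 *: r).
Proof.
move=> gh gy.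
have lin_subspace b k : is_subspace [set s | gamma R k (g s - b *: s)].
  split=> [|d u v /= gu gv].
    by rewrite /= (hom0 gh) scaler0 subrr; exact: gamma0.
  rewrite (homD gh) (homZ gh) scalerDr opprD addrACA scalerA (mulrC b).
  by rewrite -scalerA -scalerBr; apply: gammaD => //; exact: gammaZ.
have base s : gamma R 2 (g s - a *: s).
  move: s; apply: (genR (lin_subspace a 2)) => [u v _ _|i] /=.
    by rewrite (hom_lie gh); apply: gammaB; [|apply: gammaZ]; exact: gamma2_lie.
  by rewrite gy subrr; exact: gamma0.
elim: e r => [r _|e IHe]; first by rewrite expr1.
apply: (gamma_ind (lin_subspace (a ^+ e.+2) e.+3)) => u v eu /=.
rewrite (_ : _ - _ = [lie g u - a ^+ e.+1 *: u, g v]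
    + [lie a ^+ e.+1 *: u, g v - a *: v]).
  apply: gammaD; first by rewrite -addn1; apply: gamma_lie => //; exact: IHe.
  by rewrite -addn2; apply: gamma_lie => //; exact: gammaZ.
rewrite (hom_lie gh) lieBl lieBr !lieZl lieZr scalerA -exprSr.
by zmodule.
Qed.

(** Conjugation by the scalar automorphism a. *)
Lemma leadingX a u : leading c u -> leading c (a ^+ c.-1 *: u).
Proof.
have c1_gt0 : (0 < c.-1)%N by rewrite -ltnS prednK // ltnW.
move=> cu; have [->|a_neq0] := eqVneq a 0.
  rewrite expr0n gtn_eqF // scale0r.
  by apply: leading_deep => i; exact: gamma0.
have unit_a : (a%:M : 'M[K]_n) \in unitmx by rewrite -scalemx1 unitmxZ ?unitmx1 ?unitfE.
have [g [Hg gy giy]] := H_linear unit_a.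
have g_scale i : g (y i) = a *: y i.
  rewrite gy (bigD1 i) //= !mxE eqxx mulr1n big1 ?addr0 // => j /negPf ji.
  by rewrite !mxE eq_sym ji mulr0n scale0r.
apply: (leading_congr (leading_conj Hg giy cu)) => i.
rewrite invmx_scalar (bigD1 i) //= !mxE eqxx mulr1n big1 ?addr0; last first.
  by move=> j /negPf ji; rewrite !mxE eq_sym ji mulr0n scale0r.
rewrite (_ : _ - _ = - (a^-1 *: (g (u i) - a ^+ c *: u i))).
  apply/gammaN/gammaZ; rewrite -{1 2}[c](@prednK c) ?(ltnW c_gt1) //.
  by apply: scaling_gamma g_scale _; rewrite ?prednK ?(ltnW c_gt1) //;
     [exact: aut_hom|exact: cu.1].
rewrite scalerBr scalerA (_ : a ^+ c = a * a ^+ c.-1).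
  by rewrite mulKf // opprB.
by rewrite -exprS prednK // ltnW.
Qed.

Lemma leading_divn u k : (0 < k)%N -> leading c (u *+ k) -> leading c u.
Proof.
move=> k_gt0 /(leadingX k%:R^-1) /(leadingMn (k ^ c.-2)).
rewrite -!scaler_nat !scalerA [X in leading c (X *: _)](_ : _ = 1) ?scale1r //.
have k_neq0 : k%:R != 0 :> K by rewrite natr_eq0_char0 // -lt0n.
rewrite natrX exprVn mulrAC -exprSr prednK.
  by rewrite mulfV // expf_neq0.
by case: c c_gt1 => [|[]].
Qed.

(** H contains the scalar automorphisms, and conjugation by the scalar b
    multiplies a leading term of degree c by b ^ (c - 1). In characteristic 0
    every scalar is a rational combination of such powers: it is the linear
    coefficient of (1 + t a) ^ (c - 1) up to an integer factor. *)
Lemma leadingZ a u : leading c u -> leading c (a *: u).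
Proof.
move=> cu; have c1_gt0 : (0 < c.-1)%N by rewrite -ltnS prednK // ltnW.
apply: (leading_divn c1_gt0).
pose F m := (a ^+ m *+ 'C(c.-1, m)) *: u.
have -> : (a *: u) *+ c.-1 = F 1%N by rewrite /F bin1 expr1 scalerMnl.
apply: (@curve_coef K charK0 _ (leading c) c.-1.+1 F) => // [v w|v k|t].
- exact: leadingB.
- exact: leading_divn.
rewrite (_ : \sum_(m < _) _ = (1 + t%:R * a) ^+ c.-1 *: u).
  exact: leadingX.
rewrite exprDn scaler_suml; apply: eq_bigr => m _.
by rewrite expr1n mul1r exprMn scalerA mulrnAr.
Qed.

Hypothesis derR : forall m : 'I_n -> R,
  exists d : R -> R, derivation d /\ forall i, d (y i) = m i.
Variable avoid : 'I_n -> set R.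
Hypothesis avoid_gen : forall j a i, i != j -> avoid j (a *: y i).
Hypothesis H_elementary : forall j r, avoid j r ->
  exists phi : lieAut R, [/\ H phi, phi (y j) = y j + r,
    aut_inv phi (y j) = y j - r,
    forall i, i != j -> phi (y i) = y i
    & forall i, i != j -> aut_inv phi (y i) = y i].

Lemma leading_elementary j r : avoid j r -> gamma R c r -> leading c (single j r).
Proof.
move=> /H_elementary[phi [Hphi phij _ phii _]] cr; split=> [i|].
  exact: gamma_single.
exists phi => // i; rewrite /single; case: eqP => [->|/eqP /phii ->].
  by rewrite phij addrAC addrK subrr; exact: gamma0.
by rewrite subrr subr0; exact: gamma0.
Qed.

(** If g is the elementary automorphism y_j |-> y_j + w and h has the leading term
    f d/dy_i, then g h and h g differ by the bracket of the derivations
    w d/dy_j and f d/dy_i, up to terms of higher weight. *)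
Lemma leading_bracket e i j f w d1 d2 : (1 < e)%N -> i != j ->
    avoid j w -> gamma R e w -> leading c (single i f) ->
    derivation d1 -> (forall k, d1 (y k) = single j w k) ->
    derivation d2 -> (forall k, d2 (y k) = single i f k) ->
  leading (c + e).-1 (single i (d1 f) - single j (d2 w)).
Proof.
move=> e_gt1 ij aw ew [cf [h Hh hf]] dd1 d1y dd2 d2y.
have [g [Hg gj _ gi _]] := H_elementary aw.
have c_f : gamma R c f by have := cf i; rewrite /single eqxx.
have c_pred : (c.-1.+1 = c)%N by rewrite prednK // ltnW.
have e_pred : (e.-1.+1 = e)%N by rewrite prednK // ltnW.
have ce_pred : ((c + e).-1.+1 = c + e)%N by rewrite -c_pred.
have gy k : g (y k) = y k + single j w k.
  by rewrite /single; case: eqP => [->|/eqP /gi ->]; rewrite ?addr0.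
have d1_gamma k : gamma R e (d1 (y k)) by rewrite d1y; exact: gamma_single.
have d2_gamma k : gamma R c (d2 (y k)) by rewrite d2y; exact: gamma_single.
have g_f : gamma R (c + e) (g f - f - d1 f).
  rewrite (_ : (c + e = (e + c.-1).+1)%N); last by rewrite -addnS c_pred addnC.
  apply: (hom_derivation e_gt1 (aut_hom g) dd1) => [//|k|]; last by rewrite c_pred.
  rewrite gy d1y (_ : _ - _ = 0); first exact: gamma0.
  by zmodule.
have h_w : gamma R (c + e) (h w - w - d2 w).
  rewrite (_ : (c + e = (c + e.-1).+1)%N); last by rewrite -addnS e_pred.
  apply: (hom_derivation c_gt1 (aut_hom h) dd2) => [//|k|]; last by rewrite e_pred.
  by rewrite d2y.
apply: (@leading_quotient _ _ (g * h)%g (h * g)%g).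
- exact: HM.
- exact: HM.
- move=> k; rewrite -[aut_fun _ _]/(h (g (y k))) gy (homD (aut_hom h)).
  rewrite addrAC; apply: gammaD; last first.
    by apply: (gamma_hom (aut_hom h)); apply: gamma_single; exact: gamma_le ew.
  exact: (gamma_le c_gt1 (leading_increment cf (hf k))).
- move=> k; apply: gammaB; apply: gamma_single.
    rewrite (_ : (c + e).-1 = e + c.-1)%N; last by rewrite addnC -{1}c_pred addnS.
    by apply: (der_gamma dd1) => //; rewrite c_pred.
  rewrite (_ : (c + e).-1 = c + e.-1)%N; last by rewrite -e_pred addnS.
  by apply: (der_gamma dd2) => //; rewrite e_pred.
move=> k; rewrite ce_pred -[aut_fun _ _]/(g (h (y k))) -[X in _ - X - _]/(h (g (y k))).
have := hf k; set r := _ - single i f k => r_deep.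
have g_r : gamma R (c + e) (g r - r).
  rewrite addnC; apply: (hom_diff (aut_hom g) (@lie_hom_id _ _)) => // k'.
  rewrite gy (_ : _ - _ = single j w k'); first exact: gamma_single.
  by zmodule.
have hyE : h (y k) = y k + single i f k + r by rewrite /r; zmodule.
rewrite (_ : _ - _ = (g r - r) + single i (g f - f - d1 f) k
    - single j (h w - w - d2 w) k).
  by apply: gammaB; [apply: gammaD => //|]; exact: gamma_single.
rewrite hyE !(homD (aut_hom g)) gy (homD (aut_hom h)) hyE.
rewrite -[(single i _ - single j _) k]/(single i (d1 f) k - single j (d2 w) k) /single.
have [->|ki] := eqVneq k i; have [->|kj] := eqVneq; rewrite ?(hom0 (aut_hom g)) ?(hom0 (aut_hom h)).
all: by zmodule.
Qed.

(** The action of a transvection y_k |-> y_k + t y_l is polynomial in t, with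
    the derivation y_l d/dy_k as the linear coefficient. *)
Lemma transvection_curve k l d r : derivation d ->
    (forall i, d (y i) = single k (y l) i) ->
  exists s, forall t (g : R -> R), lie_hom g ->
    (forall i, g (y i) = y i + t *: single k (y l) i) ->
  g r = curve [:: r, d r & s] t.
Proof.
move=> dd dy.
pose S := [set r | exists s, forall t (g : R -> R), lie_hom g ->
  (forall i, g (y i) = y i + t *: single k (y l) i) ->
  g r = curve [:: r, d r & s] t].
apply: (genR (S := S)) => [|u v [s1 s1E] [s2 s2E]|i]; last first.
- by exists [::] => t g gh gy; rewrite gy /= dy scaler0 addr0.
- have [s3 s3E] := curve_lie (d u :: s1) (d v :: s2).
  have [s4 s4E] := curve_lie [:: u] s2.
  have [s5 s5E] := curve_lie s1 [:: v].
  have [s6 s6E] := curve_add s4 s5; have [s7 s7E] := curve_add s6 s3.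
  exists s7 => t g gh gy; rewrite (hom_lie gh) (s1E t g) // (s2E t g) //.
  rewrite /= -/(curve s7 t) s7E s6E s4E s5E s3E /= !scaler0 !addr0 (der_lie dd).
  rewrite -/(curve s1 t) -/(curve s2 t).
  rewrite !(lieDl, lieDr, lieZl, lieZr, scalerDr, scalerA).
  by zmodule.
split=> [|a u v [s1 s1E] [s2 s2E]].
  exists [::] => t g gh gy.
  by rewrite (hom0 gh) /= (der0 dd) !(scaler0, addr0).
have [s3 s3E] := curve_add [seq a *: w | w <- s1] s2.
exists s3 => t g gh gy; rewrite (homD gh) (homZ gh) (s1E t g) // (s2E t g) //.
rewrite /= -/(curve s3 t) s3E (derD dd) (derZ dd).
have -> : curve [seq a *: w | w <- s1] t = a *: curve s1 t.
  elim: {s1E s3E s3} s1 => [|w s1 IHs] /=; first by rewrite scaler0.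
  by rewrite IHs scalerDr !scalerA mulrC.
rewrite -/(curve s1 t) -/(curve s2 t) !(scalerDr, scalerA) !(mulrC _ a) !mulrA.
by rewrite -![a * t * t]mulrA; zmodule.
Qed.

Lemma leading_transvection k l t i f : k != l -> leading c (single i f) ->
  exists g : R -> R, [/\ lie_hom g,
    forall j, g (y j) = y j + t *: single k (y l) j &
    leading c (single i (g f) - t *: (if i == l then single k (g f) else 0))].
Proof.
move=> kl cf; have lk : l != k by rewrite eq_sym.
have [g [Hg gk gik gi gii]] := H_elementary (avoid_gen t lk).
exists g; split=> [|j|]; first exact: aut_hom.
  rewrite /single; case: eqP => [->//|/eqP /gi ->].
  by rewrite scaler0 addr0.
pose B (a b : 'I_n) : K := (b == a)%:R - t * ((a == k) && (b == l))%:R.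
have gB a : aut_inv g (y a) = \sum_b B a b *: y b.
  under eq_bigr do rewrite scalerBl; rewrite sumrB.
  rewrite (bigD1 a) //= eqxx scale1r big1 ?addr0 => [|b /negPf ->]; last first.
    by rewrite scale0r.
  rewrite (bigD1 l) //= eqxx big1 ?addr0 => [|b /negPf ->]; last first.
    by rewrite andbF mulr0 scale0r.
  rewrite andbT; have [->|ak] := eqVneq a k; first by rewrite mulr1.
  by rewrite mulr0 scale0r subr0 gii.
apply: (leading_ext (leading_conj Hg gB cf)) => a.
rewrite (bigD1 i) //= big1 ?addr0 => [|b /negPf bi]; last first.
  by rewrite /single bi (hom0 (aut_hom g)) scaler0.
rewrite -[RHS]/(single i (g f) a - t *: (if i == l then single k (g f) else 0) a).
rewrite /single eqxx /B (eq_sym i a); case: (i == l).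
  rewrite andbT; have [_|_] := eqVneq a i; have [_|_] := eqVneq a k;
    by rewrite ?mulr1 ?mulr0 scalerBl ?scale1r ?scale0r ?scaler0.
rewrite andbF mulr0 subr0 -[(0 : 'I_n -> R) a]/0 scaler0 subr0.
by case: (a == i); rewrite ?scale1r ?scale0r.
Qed.

Lemma singleD i f g : single i (f + g) = single i f + single i g.
Proof.
apply/funext => k; rewrite -[RHS]/(single i f k + single i g k) /single.
by case: eqP => _ //; rewrite addr0.
Qed.

Lemma singleZ i a f : single i (a *: f) = a *: single i f.
Proof.
apply/funext => k; rewrite -[RHS]/(a *: single i f k) /single.
by case: eqP => _ //; rewrite scaler0.
Qed.

Lemma single0 i : single i 0 = 0.
Proof. by apply/funext => k; rewrite /single if_same. Qed.

Lemma singleN i f : single i (- f) = - single i f.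
Proof. by rewrite -!scaleN1r singleZ. Qed.

Lemma singleB i f g : single i (f - g) = single i f - single i g.
Proof. by rewrite singleD singleN. Qed.

(** The infinitesimal form of conjugation by the transvections
    y_k |-> y_k + t y_l. *)
Lemma leading_polarize k l i f d : k != l -> derivation d ->
    (forall j, d (y j) = single k (y l) j) -> leading c (single i f) ->
  leading c (single i (d f) - (if i == l then single k f else 0)).
Proof.
move=> kl dd dy cf; have [s sE] := transvection_curve f dd dy.
pose T (r : R) := if i == l then single k r else 0.
have TD r1 r2 : T (r1 + r2) = T r1 + T r2.
  by rewrite /T; case: eqP => _; rewrite ?singleD ?addr0.
have TZ a r : T (a *: r) = a *: T r.
  by rewrite /T; case: eqP => _; rewrite ?singleZ ?scaler0.
have T0 : T 0 = 0 by rewrite /T single0 if_same.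
pose s' := [:: f, d f & s].
pose F m := single i s'`_m - T (0 :: s')`_m.
rewrite -/(T f) (_ : _ - _ = F 1%N) //.
apply: (@curve_coef K charK0 _ (leading c) (size s').+1 F) => // [v w|v m|t].
- exact: leadingB.
- exact: leading_divn.
have [g [gh gy]] := leading_transvection t%:R kl cf.
rewrite (sE _ _ gh gy) -/(T _) -/s' => gf.
rewrite (_ : \sum_(m < _) _ = single i (curve s' t%:R) - t%:R *: T (curve s' t%:R)) //.
rewrite !curveE /F; under eq_bigr do rewrite scalerBr -singleZ -TZ.
rewrite sumrB big_ord_recr /= nth_default // scaler0 single0 addr0.
rewrite [X in _ - X]big_ord_recl [_`_ (ord0 : 'I__)]/= scaler0 T0 add0r.
congr (_ - _); first by rewrite (big_morph _ (singleD i) (single0 i)).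
rewrite -TZ scaler_sumr (big_morph _ TD T0) /=.
by apply: eq_bigr => m _; rewrite /= scalerA -exprS.
Qed.

End Filtration.
(** * Words in a fixed system of generators *)

Section Words.
Variables (K : fieldType) (n : nat) (R : lieAlgType K) (y : 'I_n -> R).

Definition act (w : R) (p : seq 'I_n) : R := foldl (fun u k => [lie u, y k]) w p.

Definition comm (a b : 'I_n) : R := [lie y a, y b].

Lemma act_cat w p q : act w (p ++ q) = act (act w p) q.
Proof. exact: foldl_cat. Qed.

Lemma actD u v p : act (u + v) p = act u p + act v p.
Proof. by elim: p u v => //= k p IHp u v; rewrite lieDl IHp. Qed.

Lemma actZ a u p : act (a *: u) p = a *: act u p.
Proof. by elim: p u => //= k p IHp u; rewrite lieZl IHp. Qed.

Lemma act0 p : act 0 p = 0.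
Proof. by elim: p => //= k p; rewrite lie0l. Qed.

Lemma actN u p : act (- u) p = - act u p.
Proof. by rewrite -!scaleN1r actZ. Qed.

Lemma actB u v p : act (u - v) p = act u p - act v p.
Proof. by rewrite actD actN. Qed.

Lemma act_gamma e w p : gamma R e w -> gamma R (e + size p) (act w p).
Proof.
elim: p e w => [|k p IHp] e w ew /=; first by rewrite addn0.
by rewrite -addSnnS; apply: IHp; rewrite -addn1; exact: gamma_lie.
Qed.

Lemma comm_gamma a b : gamma R 2 (comm a b).
Proof. exact: gamma2_lie. Qed.

Lemma act_gamma2 w p : gamma R 2 w -> gamma R 2 (act w p).
Proof. by move=> w2; apply: gamma_le (act_gamma p w2); rewrite leq_addr. Qed.

Lemma commC a b : comm a b = - comm b a.
Proof. exact: lieC. Qed.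

Lemma commxx a : comm a a = 0.
Proof. exact: bracketxx. Qed.

Lemma comm_jacobi a b c p :
  act (comm a b) (c :: p) = act (comm a c) (b :: p) - act (comm b c) (a :: p).
Proof. by rewrite /= -actB; congr act; exact: lie_jacobi. Qed.

Lemma act_perm (S : R -> Prop) w p q :
  (forall u v, S u -> S v -> S (u + v)) -> S 0 ->
  (forall p1 k l p2, (size (p1 ++ k :: l :: p2) = size p)%N ->
    S (act w (p1 ++ k :: l :: p2) - act w (p1 ++ l :: k :: p2))) ->
  perm_eq p q -> S (act w p - act w q).
Proof.
move=> SD S0.
have move_front w' k q1 q2 : (forall p1 j l p2,
    (size (p1 ++ j :: l :: p2) = size (k :: q1 ++ q2))%N ->
    S (act w' (p1 ++ j :: l :: p2) - act w' (p1 ++ l :: j :: p2))) ->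
    S (act w' (k :: q1 ++ q2) - act w' (q1 ++ k :: q2)).
  elim: q1 w' => [|j q1 IHq] w' S_swap; first by rewrite subrr.
  rewrite -[X in S X](subrKA (act w' (j :: k :: q1 ++ q2))); apply: SD.
    by apply: (S_swap [::]).
  apply: (IHq [lie w', y j]) => p1 i l p2 sz.
  by apply: (S_swap (j :: p1)); rewrite /= sz.
elim: p w q => [|k p IHp] w q S_swap perm_pq.
  by move: perm_pq; rewrite perm_sym => /perm_nilP ->; rewrite subrr.
have kq : k \in q by rewrite -(perm_mem perm_pq) mem_head.
have [q1 [q2 qE]] : exists q1 q2, q = q1 ++ k :: q2.
  by case/splitPr: kq => q1 q2; exists q1, q2.
rewrite {}qE in perm_pq *; move: perm_pq.
rewrite -[k :: q2]cat1s perm_sym perm_catCA perm_sym /= perm_cons => perm_pq.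
rewrite -[X in S X](subrKA (act w (k :: q1 ++ q2))); apply: SD; last first.
  by apply: move_front => p1 j l p2 sz; apply: S_swap; rewrite sz /= (perm_size perm_pq).
apply: (IHp [lie w, y k]) => // p1 j l p2 sz.
by apply: (S_swap (k :: p1)); rewrite /= sz.
Qed.

(** Reordering a word costs an element of the second derived algebra when w lies
    in the derived algebra. *)
Lemma act_swap w p1 k l p2 :
  act w (p1 ++ k :: l :: p2) - act w (p1 ++ l :: k :: p2) =
  - act [lie comm k l, act w p1] p2.
Proof.
rewrite !act_cat /= -actB -actN; congr act.
by rewrite lie_leibniz addrAC subrr add0r lieC.
Qed.

Variable d : R -> R.
Hypothesis dd : derivation d.

Lemma der_comm a b : d (comm a b) = [lie d (y a), y b] + [lie y a, d (y b)].
Proof. exact: der_lie. Qed.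

Lemma der_act (S : R -> Prop) w p : (forall u v, S u -> S v -> S (u + v)) ->
  S 0 -> (forall p1 k p2, p = p1 ++ k :: p2 ->
    S (act [lie act w p1, d (y k)] p2)) ->
  S (d (act w p) - act (d w) p).
Proof.
move=> SD S0; elim: p w => [|k p IHp] w Sp /=; first by rewrite subrr.
rewrite -[X in S X](subrKA (act (d [lie w, y k]) p)); apply: SD.
  by apply: IHp => p1 l p2 pE; apply: (Sp (k :: p1)); rewrite pE.
by rewrite (der_lie dd) actD addrAC subrr add0r; exact: (Sp [::]).
Qed.

Lemma der_act_const w p : (forall k, k \in p -> d (y k) = 0) ->
  d (act w p) = act (d w) p.
Proof.
move=> dp; apply/eqP; rewrite -subr_eq0; apply/eqP.
apply: (der_act (S := eq^~ 0)) => // [u v -> ->|p1 k p2 pE]; first by rewrite addr0.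
by rewrite dp ?lie0r ?act0 // pE mem_cat mem_head orbT.
Qed.

Hypothesis laws : variety_laws R.

Lemma lie_center u v w : gamma R 2 u -> gamma R 2 v -> gamma R 2 w ->
  [lie w, [lie u, v]] = 0.
Proof. by move=> u2 v2 w2; rewrite lieC laws.1 // oppr0. Qed.

(** The centralizer of the derived algebra. It is an ideal, and by the first law
    it contains the second derived algebra. *)
Definition central (u : R) : Prop := forall v, gamma R 2 v -> [lie v, u] = 0.

Lemma centralD u v : central u -> central v -> central (u + v).
Proof. by move=> cu cv w w2; rewrite lieDr cu // cv // addr0. Qed.

Lemma central0 : central 0.
Proof. by move=> v _; rewrite lie0r. Qed.

Lemma central_lie u v : gamma R 2 u -> gamma R 2 v -> central [lie u, v].
Proof. by move=> u2 v2 w w2; rewrite lie_center. Qed.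

Lemma centralN u : central u -> central (- u).
Proof. by move=> cu w w2; rewrite lieNr cu // oppr0. Qed.

Lemma central_act u p : central u -> central (act u p).
Proof.
elim: p u => //= k p IHp u cu; apply: IHp => v v2.
have -> : [lie v, [lie u, y k]] = [lie v, u, y k] - [lie [lie v, y k], u].
  by rewrite lie_leibniz addrC addKr.
rewrite cu // lie0l cu ?subr0 //; apply: (@gamma_le _ _ _ 3) => //.
by rewrite -[3%N]/(2 + 1)%N; exact: gamma_lie.
Qed.

(** In a bracket with an element of the derived algebra, the letters of a word
    behave like commuting variables. *)
Lemma lie_act_perm v w p q : gamma R 2 v -> gamma R 2 w -> perm_eq p q ->
  [lie v, act w p] = [lie v, act w q].
Proof.
move=> v2 w2 perm_pq; apply/eqP; rewrite -subr_eq0 -lieBr; apply/eqP.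
suff cpq : central (act w p - act w q) by exact: cpq.
apply: act_perm => //; [exact: centralD|exact: central0|].
move=> p1 k l p2 _; rewrite act_swap; apply: centralN; apply: central_act.
by apply: central_lie; [exact: comm_gamma|exact: act_gamma2].
Qed.

(** Commutators of weight at least 3 commute, so in [v, z] with z of weight
    at least 3 a further factor acts on z only. *)
Lemma act_lie v z p : gamma R 2 v -> gamma R 3 z ->
  act [lie v, z] p = [lie v, act z p].
Proof.
elim: p z => //= k p IHp z v2 z3; rewrite -IHp //; last first.
  by apply: (@gamma_le _ _ _ 4) => //; rewrite -[4%N]/(3 + 1)%N; exact: gamma_lie.
congr act; rewrite lie_leibniz laws.2 ?add0r //.
by rewrite -[3%N]/(2 + 1)%N; exact: gamma_lie.
Qed.

Lemma lie_der_act v w p : gamma R 2 v -> gamma R 2 w ->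
  (forall k, gamma R 2 (d (y k))) ->
  [lie v, d (act w p)] = [lie v, act (d w) p].
Proof.
move=> v2 w2 d2; apply/eqP; rewrite -subr_eq0 -lieBr; apply/eqP.
suff c_d : central (d (act w p) - act (d w) p) by exact: c_d.
apply: der_act => [||p1 k p2 _]; [exact: centralD|exact: central0|].
by apply/central_act/central_lie => //; exact: act_gamma2.
Qed.

Lemma lie_polarize_act v w p k l : gamma R 2 v -> gamma R 2 w ->
  (forall j, d (y j) = single k (y l) j) ->
  [lie v, d (act w p)] =
    [lie v, act (d w) p] + [lie v, act w (l :: rem k p)] *+ count_mem k p.
Proof.
move=> v2 w2 dy; elim: p w w2 => [|j p IHp] w w2 /=; first by rewrite addr0.
have wj2 u : gamma R 2 [lie w, u].
  by apply: (@gamma_le _ _ _ 3) => //; rewrite -[3%N]/(2 + 1)%N; exact: gamma_lie.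
rewrite IHp // (der_lie dd) actD lieDr -addrA; congr (_ + _).
rewrite dy /single; have [jk|jk] := eqVneq j k.
  rewrite jk mulrS; congr (_ + _).
  have [kp|k_notin_p] := boolP (k \in p).
    congr (_ *+ _); rewrite -[LHS]/([lie v, act w [:: k, l & rem k p]]).
    rewrite -[RHS]/([lie v, act w (l :: p)]); apply: lie_act_perm => //.
    rewrite (_ : [:: k, l & _] = [:: k] ++ [:: l] ++ rem k p) // perm_catCA /=.
    by rewrite perm_cons perm_sym perm_to_rem.
  by rewrite (count_memPn k_notin_p) !mulr0n.
rewrite lie0r act0 lie0r !add0r; congr (_ *+ _).
rewrite -[LHS]/([lie v, act w [:: j, l & rem k p]]).
rewrite -[RHS]/([lie v, act w [:: l, j & rem k p]]); apply: lie_act_perm => //.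
by rewrite (_ : [:: j, l & _] = [:: j] ++ [:: l] ++ rem k p) // perm_catCA.
Qed.

End Words.

Lemma fresh_ord n (s : seq 'I_n) : (size s < n)%N -> exists j, j \notin s.
Proof.
move=> sz; apply/existsP; apply: contraTT sz.
rewrite negb_exists -leqNgt => /forallP all_in.
apply: leq_trans (card_size s); rewrite -[leqLHS]card_ord.
apply: subset_leq_card.
by apply/fintype.subsetP => j _; move: (all_in j); rewrite negbK.
Qed.
(** * The leading terms with values in the second derived algebra *)

Lemma perm_gather (T : eqType) (i : T) (q : seq T) :
  perm_eq q (nseq (count_mem i q) i ++ [seq x <- q | x != i]).
Proof.
rewrite perm_sym (_ : nseq _ _ = [seq x <- q | pred1 i x]).
  exact/permPl/perm_filterC.
by apply/esym; rewrite -size_filter; apply/all_pred1P; exact: filter_all.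
Qed.

Section LeadingTerms.
Variables (K : fieldType) (n : nat) (R : lieAlgType K) (y : 'I_n -> R).
Hypothesis charK0 : [pchar K] =i pred0.
Hypothesis n_ge4 : (4 <= n)%N.
Hypothesis laws : variety_laws R.
Hypothesis derR : forall m : 'I_n -> R,
  exists d : R -> R, derivation d /\ forall i, d (y i) = m i.
Variable avoid : 'I_n -> set R.
Hypothesis avoid_gen : forall j i, i != j -> avoid j (y i).
Hypothesis avoid_lie :
  forall j u v, avoid j u -> avoid j v -> avoid j [lie u, v].

(* X c u is to be read as: the tuple u, that is the derivation y_i |-> u_i, is a
   leading term of degree c. The closure properties below are all that the
   combinatorial argument uses. *)
Variable X : nat -> ('I_n -> R) -> Prop.
Hypothesis X0 : forall c, X c 0.
Hypothesis XB : forall c u v, (1 < c)%N -> X c u -> X c v -> X c (u - v).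
Hypothesis XZ : forall c a u, (1 < c)%N -> X c u -> X c (a *: u).
Hypothesis X_polarize : forall c k l i f d, (1 < c)%N -> k != l ->
  derivation d -> (forall j, d (y j) = single k (y l) j) ->
  X c (single i f) -> X c (single i (d f) - (if i == l then single k f else 0)).
Hypothesis X_bracket : forall c e i j f w d1 d2, (1 < c)%N -> (1 < e)%N ->
  i != j -> avoid j w -> gamma R e w -> X c (single i f) ->
  derivation d1 -> (forall k, d1 (y k) = single j w k) ->
  derivation d2 -> (forall k, d2 (y k) = single i f k) ->
  X (c + e).-1 (single i (d1 f) - single j (d2 w)).
Hypothesis X_elementary : forall c j r, avoid j r -> gamma R c r ->
  X c (single j r).

Local Notation comm := (comm y).
Local Notation act := (act y).

Hypothesis X_omega : forall k a b c d, uniq [:: a; b; c; d] ->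
  X (4 + k) (single a [lie act (comm a b) (nseq k a), comm c d]).

Lemma XN c u : (1 < c)%N -> X c u -> X c (- u).
Proof. by move=> c1 cu; rewrite -scaleN1r; exact: XZ. Qed.

Lemma XD c u v : (1 < c)%N -> X c u -> X c v -> X c (u + v).
Proof. by move=> c1 cu cv; rewrite -[v]opprK; apply: XB => //; exact: XN. Qed.

Lemma X_divn c u k : (1 < c)%N -> (0 < k)%N -> X c (u *+ k) -> X c u.
Proof.
move=> c1 k_gt0 /(XZ k%:R^-1 c1); rewrite -scaler_nat scalerA mulVf ?scale1r //.
by rewrite natr_eq0_char0 // -lt0n.
Qed.

Definition X1 c i f := X c (single i f).

Lemma X1_0 c i : X1 c i 0.
Proof. by rewrite /X1 single0. Qed.

Lemma X1D c i f g : (1 < c)%N -> X1 c i f -> X1 c i g -> X1 c i (f + g).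
Proof. by move=> c1; rewrite /X1 singleD; exact: XD. Qed.

Lemma X1N c i f : (1 < c)%N -> X1 c i f -> X1 c i (- f).
Proof. by move=> c1; rewrite /X1 singleN; exact: XN. Qed.

Lemma X1B c i f g : (1 < c)%N -> X1 c i f -> X1 c i g -> X1 c i (f - g).
Proof. by move=> c1; rewrite /X1 singleB; exact: XB. Qed.

Lemma X1Mn c i f k : (1 < c)%N -> X1 c i f -> X1 c i (f *+ k).
Proof.
move=> c1 cf; elim: k => [|k IHk]; first by rewrite mulr0n; exact: X1_0.
by rewrite mulrS; exact: X1D.
Qed.

Lemma X1_divn c i f k : (1 < c)%N -> (0 < k)%N -> X1 c i (f *+ k) -> X1 c i f.
Proof.
move=> c1 k_gt0; rewrite /X1 -scaler_nat singleZ scaler_nat; exact: X_divn.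
Qed.

Lemma ex_polarization k l :
  exists d : R -> R, derivation d /\ forall j, d (y j) = single k (y l) j.
Proof. exact: derR. Qed.

Lemma X1_polarize c k l i f d : (1 < c)%N -> k != l -> i != l ->
  derivation d -> (forall j, d (y j) = single k (y l) j) ->
  X1 c i f -> X1 c i (d f).
Proof.
move=> c1 kl il dd dy cf; have := X_polarize c1 kl dd dy cf.
by rewrite (negPf il) subr0.
Qed.

Lemma X_polarize_eq c k l f d : (1 < c)%N -> k != l ->
  derivation d -> (forall j, d (y j) = single k (y l) j) ->
  X1 c l f -> X c (single l (d f) - single k f).
Proof.
move=> c1 kl dd dy cf; have := X_polarize c1 kl dd dy cf.
by rewrite eqxx.
Qed.

Lemma polarize_comm k l d (dd : derivation d)
    (dy : forall j, d (y j) = single k (y l) j) a b :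
  d (comm a b) = comm l b *+ (a == k) + comm a l *+ (b == k).
Proof.
rewrite der_comm // !dy /single.
by case: eqP; case: eqP => _ _; rewrite ?lie0l ?lie0r ?mulr1n ?mulr0n.
Qed.

Lemma polarize_lie k l d (dd : derivation d)
    (dy : forall j, d (y j) = single k (y l) j) a b c e p :
  d [lie comm a b, act (comm c e) p] = [lie d (comm a b), act (comm c e) p]
    + ([lie comm a b, act (d (comm c e)) p]
       + [lie comm a b, act (comm c e) (l :: rem k p)] *+ count_mem k p).
Proof.
by rewrite (der_lie dd) (lie_polarize_act dd laws p _ _ dy) //; exact: comm_gamma.
Qed.

Lemma avoid_comm i a b : a != i -> b != i -> avoid i (comm a b).
Proof. by move=> ai bi; apply: avoid_lie; exact: avoid_gen. Qed.

Lemma avoid_act i w p : avoid i w -> i \notin p -> avoid i (act w p).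
Proof.
elim: p w => //= k p IHp w iw; rewrite inE negb_or eq_sym => /andP[ki ip].
by apply: IHp => //; apply: avoid_lie => //; exact: avoid_gen.
Qed.

Lemma act_perm_lie a b c d p q : perm_eq p q ->
  [lie comm a b, act (comm c d) p] = [lie comm a b, act (comm c d) q].
Proof. by apply: lie_act_perm => //; exact: comm_gamma. Qed.

Lemma gamma_comm_act a b p : gamma R (2 + size p) (act (comm a b) p).
Proof. by apply: act_gamma; exact: comm_gamma. Qed.

(** Polarizing y_i to y_s in [y_i, y_b] i ^ r p and y_i to y_b in
    [y_i, y_s] i ^ r p, the Jacobi identity turns the results into (r + 1) x - z
    and (r + 1) z - x; hence ((r + 1) ^ 2 - 1) x is reached. *)
Lemma X1_head_i i b c e k p : i != b -> c != i -> e != i -> c != e ->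
  i \notin p ->
  X1 (4 + (k + size p)) i [lie comm c e, act (comm i b) (nseq k i ++ p)].
Proof.
move=> + ci ei ce; elim: p k b => [|s p IHp] k b ib.
  move=> _; rewrite cats0 addn0.
  have distinct_case b' : b' \notin [:: i; c; e] ->
      X1 (4 + k) i [lie comm c e, act (comm i b') (nseq k i)].
    rewrite !inE !negb_or => /and3P[b'i b'c b'e].
    rewrite lieC; apply: X1N => //; apply: X_omega.
    by rewrite /= !inE !negb_or ce (eq_sym i) b'i b'c b'e (eq_sym i) ci (eq_sym i) ei.
  have [b_in|b_out] := boolP (b \in [:: c; e]); last first.
    by apply: distinct_case; rewrite inE negb_or (eq_sym b) ib.
  have [b' b'_out] := fresh_ord (n_ge4 : (size [:: i; c; e] < n)%N).
  have [d [dd dy]] := ex_polarization b' b.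
  move: (b'_out); rewrite !inE !negb_or => /and3P[b'i b'c b'e].
  have b'b : b' != b.
    by apply: contraNneq b'_out => ->; rewrite inE b_in orbT.
  have := X1_polarize (isT : 1 < 4 + k)%N b'b ib dd dy (distinct_case _ b'_out).
  rewrite (polarize_lie dd dy) !(polarize_comm dd dy).
  rewrite (eq_sym c) (negPf b'c) (eq_sym e) (negPf b'e) (eq_sym i) (negPf b'i).
  rewrite eqxx !mulr0n mulr1n !add0r lie0l add0r.
  rewrite (count_memPn _) ?mulr0n ?addr0 //.
  by apply/negP => /nseqP[b'E _]; rewrite b'E eqxx in b'i.
rewrite inE negb_or => /andP[is_ ip]; rewrite addnS -addSn.
set q := nseq k i ++ p; set N := (4 + _)%N.
have N1 : (1 < N)%N by [].
have {}IHp b' : i != b' -> X1 N i [lie comm c e, act (comm i b') (i :: q)].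
  by move=> ib'; exact: (IHp k.+1 b' ib' ip).
have count_q : count_mem i (i :: q) = k.+1.
  by rewrite /= eqxx count_cat count_nseq (count_memPn ip) addn0 /= eqxx mul1n.
have rem_q : rem i (i :: q) = q by rewrite /= eqxx.
have step b1 b2 : i != b1 -> i != b2 ->
    X1 N i ([lie comm c e, act (comm i b1) (b2 :: q)] *+ k.+2
      - [lie comm c e, act (comm i b2) (b1 :: q)]).
  move=> ib1 ib2; have [d [dd dy]] := ex_polarization i b2.
  have := X1_polarize N1 ib2 ib2 dd dy (IHp b1 ib1).
  rewrite (polarize_lie dd dy) !(polarize_comm dd dy) count_q rem_q.
  rewrite (negPf ci) (negPf ei) eqxx (eq_sym b1) (negPf ib1) !mulr0n mulr1n.
  rewrite !addr0 lie0l add0r [X in [lie _, X]]comm_jacobi.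
  rewrite (commC _ b2 i) (commC _ b1 i).
  rewrite !actN lieBr !lieNr (mulrS _ k.+1); congr (X1 N i _); zmodule.
have x_z := X1Mn k.+2 N1 (step b s ib is_); have z_x := step s b is_ ib.
apply: (@X1_divn N i _ (k.+1 * k.+3) N1 isT).
rewrite (act_perm_lie _ _ _ _ (q := s :: q)).
  move: (X1D N1 x_z z_x); congr (X1 N i _).
  set x := [lie _, _]; set z := [lie _, _].
  rewrite (_ : k.+1 * k.+3 = k.+2 * k.+2 - 1)%N; last first.
    by rewrite !(mulSn, mulnS); lia.
  by rewrite mulrnBr // mulr1n mulrnBl -mulrnA subrKA.
by rewrite -cat1s perm_catCA.
Qed.

(** If f contains y_i, the Jacobi identity and the commutation of letters bring
    y_i to the head of f; otherwise [v, f] d/dy_i is tame. *)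
Lemma X1_avoiding i c e a b p : c != i -> e != i ->
  X1 (4 + size p) i [lie comm c e, act (comm a b) p].
Proof.
move=> ci ei; have N1 : (1 < 4 + size p)%N by [].
have [<-|ce] := eqVneq c e; first by rewrite commxx lie0l; exact: X1_0.
have head b' q : i != b' -> size q = size p ->
    X1 (4 + size p) i [lie comm c e, act (comm i b') q].
  move=> ib' qp; have q_perm := perm_gather i q.
  rewrite (act_perm_lie _ _ _ _ q_perm) -qp (perm_size q_perm) size_cat size_nseq.
  by apply: X1_head_i => //; rewrite mem_filter eqxx.
have [->|ai] := eqVneq a i.
  have [->|bi] := eqVneq b i; first by rewrite commxx act0 lie0r; exact: X1_0.
  by apply: head; rewrite // eq_sym.
have [->|bi] := eqVneq b i.
  by rewrite (commC _ a) actN lieNr; apply: X1N => //; apply: head; rewrite // eq_sym.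
have [ip|ip] := boolP (i \in p); last first.
  apply: X_elementary.
    by apply: avoid_lie; [|apply: avoid_act ip]; exact: avoid_comm.
  by apply: (@gamma_lie _ _ 2 (2 + size p)); [exact: comm_gamma|exact: gamma_comm_act].
rewrite (act_perm_lie _ _ _ _ (perm_to_rem ip)) comm_jacobi lieBr.
have sz d : size (d :: rem i p) = size p by rewrite (perm_size (perm_to_rem ip)).
apply: X1B => //.
  by rewrite (commC _ a) actN lieNr; apply: X1N => //; apply: head; rewrite ?sz // eq_sym.
by rewrite (commC _ b) actN lieNr; apply: X1N => //; apply: head; rewrite ?sz // eq_sym.
Qed.

(** The polarization from y_k to y_i moves the generator paired with the
    derivative, so the class of [[y_i, y_c], f] d/dy_i is independent of i. *)
Lemma X_move_index i k c a b p : i != c -> k != c ->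
  X (4 + size p) (single i [lie comm i c, act (comm a b) p]
    - single k [lie comm k c, act (comm a b) p]).
Proof.
have [-> _ _|ik] := eqVneq i k; first by rewrite subrr.
rewrite (eq_sym i) => ci kc; have N1 : (1 < 4 + size p)%N by [].
have [d [dd dy]] := ex_polarization k i; have ki : k != i by rewrite eq_sym.
have := X_polarize_eq N1 ki dd dy (X1_avoiding a b p ki ci).
set S := single k _; rewrite (polarize_lie dd dy) !(polarize_comm dd dy) eqxx.
rewrite (eq_sym c) (negPf kc) mulr1n mulr0n addr0 singleD.
set A := single i [lie comm i c, _]; set B := single i _ => Xk.
rewrite (_ : A - S = A + B - S - B); last by zmodule.
apply: XB => //; rewrite /B {Xk B} actD lieDr; apply: X1D => //.
  apply: X1D => //; [case: (a == k)|case: (b == k)];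
    rewrite ?mulr0n ?act0 ?lie0r ?mulr1n; by [exact: X1_avoiding|exact: X1_0].
have [kp|kp] := boolP (k \in p); last first.
  by rewrite (count_memPn kp); exact: X1_0.
apply: X1Mn => //; rewrite (_ : size p = size (i :: rem k p)); first exact: X1_avoiding.
by rewrite (perm_size (perm_to_rem kp)).
Qed.

(** By X_move_index it is enough to check the condition for one i. *)
Definition reached_with d a b p :=
  forall i, i != d -> X1 (4 + size p) i [lie comm i d, act (comm a b) p].

Lemma reached_with_any i d a b p : i != d ->
  X1 (4 + size p) i [lie comm i d, act (comm a b) p] -> reached_with d a b p.
Proof.
move=> id Xi k kd; rewrite /X1 -[single k _](subKr (single i
  [lie comm i d, act (comm a b) p])).
by apply: XB => //; exact: X_move_index.
Qed.

Lemma reached_with_perm d a b p q : perm_eq p q -> reached_with d a b p ->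
  reached_with d a b q.
Proof.
move=> pq Xp i id; rewrite -(act_perm_lie _ _ _ _ pq) -(perm_size pq).
exact: Xp.
Qed.

Lemma reached_withC d a b p : reached_with d a b p -> reached_with d b a p.
Proof.
by move=> Xab i id; rewrite (commC _ b) actN lieNr; apply: X1N => //; exact: Xab.
Qed.

Lemma reached_with_jacobi d a b e p : reached_with d a e (b :: p) ->
  reached_with d b e (a :: p) -> reached_with d a b (e :: p).
Proof.
by move=> Xae Xbe i id; rewrite comm_jacobi lieBr; apply: X1B; auto.
Qed.

(** The bracket of [y_a, y_a'] d/dy_j with a leading term in which y_j occurs
    only at the head of the second factor replaces that head by [y_a, y_a']. *)
Lemma reached_with_bracket d a a' b p i j : a != i -> a' != i -> a != j ->
  a' != j -> i != j -> b != j -> i != d -> [|| d != j, p != [::] | b != i] ->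
  X1 (4 + size p) i [lie comm i d, act (comm j b) p] ->
  reached_with d a a' (b :: p).
Proof.
move=> ai a'i aj a'j ij bj id ok Xf; apply: (reached_with_any id).
have [d1 [dd1 d1y]] := derR (single j (comm a a')).
have [d2 [dd2 d2y]] := derR (single i [lie comm i d, act (comm j b) p]).
have N1 : (1 < 4 + size p)%N by [].
have := X_bracket N1 (isT : 1 < 2)%N ij (avoid_comm aj a'j) (comm_gamma y a a')
  Xf dd1 d1y dd2 d2y.
have -> : d2 (comm a a') = 0.
  by rewrite der_comm // !d2y /single (negPf ai) (negPf a'i) lie0l lie0r addr0.
rewrite single0 subr0 addn2 /= -[(4 + size p).+1]/(4 + size (b :: p))%N.
have d1_gamma k : gamma R 2 (d1 (y k)).
  by rewrite d1y; apply: gamma_single; exact: comm_gamma.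
rewrite (der_lie dd1).
rewrite (lie_der_act dd1 laws p (comm_gamma y i d) (comm_gamma y j b) d1_gamma) => Xsum.
have -> : [lie comm i d, act (comm a a') (b :: p)] =
    [lie comm i d, act (d1 (comm j b)) p].
  rewrite (der_comm y dd1) !d1y /single eqxx (negPf bj) lie0r addr0.
  by [].
rewrite -[[lie comm i d, _]](addKr [lie d1 (comm i d), act (comm j b) p]) addrC.
apply: X1B => //; rewrite (der_comm y dd1) !d1y /single (negPf ij) lie0l add0r.
have [dj|_] := eqVneq d j; last by rewrite lie0r lie0l; exact: X1_0.
have w3 : gamma R 3 [lie comm a a', y i].
  by rewrite -[3%N]/(2 + 1)%N; apply: gamma_lie => //; exact: comm_gamma.
rewrite [X in [lie X, _]]lieC.
have [p0|p_neq0] := eqVneq p [::].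
  rewrite p0 /= lieNl -lieC; rewrite p0 dj eqxx /= in ok.
  rewrite -[[lie comm a a', y i]]/(act (comm a a') [:: i]).
  by apply: (@X1_avoiding i j b a a' [:: i]); rewrite // eq_sym.
rewrite lieNl laws.2 ?oppr0 //; first exact: X1_0.
apply: (@gamma_le _ _ 3 (2 + size p)); last exact: gamma_comm_act.
by case: (p) p_neq0.
Qed.

(** In weight 4 the two factors play symmetric roles, so only [[y_i, y_b], [y_i, y_d]]
    d/dy_i is left by the previous lemmas; it is a polarization of
    [[y_i, y_b], [y_k, y_d]] d/dy_i. *)
Lemma X1_weight4 i a b c d : X1 4 i [lie comm a b, comm c d].
Proof.
have avoidingl a' b' c' d' : a' != i -> b' != i ->
    X1 4 i [lie comm a' b', comm c' d'].
  by move=> a'i b'i; exact: (@X1_avoiding i a' b' c' d' [::]).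
have avoidingr a' b' c' d' : c' != i -> d' != i ->
    X1 4 i [lie comm a' b', comm c' d'].
  by move=> c'i d'i; rewrite lieC; apply: X1N => //; exact: avoidingl.
have both b' d' : b' != i -> d' != i -> X1 4 i [lie comm i b', comm i d'].
  move=> b'i d'i; have [k] := fresh_ord (n_ge4 : (size [:: i; b'; d'] < n)%N).
  rewrite !inE !negb_or => /and3P[ki kb' kd'].
  have [e [de ey]] := ex_polarization k i.
  have := X_polarize_eq (isT : 1 < 4)%N ki de ey (avoidingr i b' k d' ki d'i).
  rewrite (der_lie de) !(polarize_comm de ey) eqxx (eq_sym i) (negPf ki).
  rewrite (eq_sym b') (negPf kb') (eq_sym d') (negPf kd') !mulr0n mulr1n !addr0.
  rewrite lie0l add0r => Xi.
  rewrite /X1 -[single i _](subrK (single k [lie comm i b', comm k d'])).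
  apply: XD => //; rewrite -[X4 in X 4 X4]/(single k _).
  apply: (@X1_avoiding k i b' k d' [::]); rewrite eq_sym //.
have [<-|ab] := eqVneq a b; first by rewrite commxx lie0l; exact: X1_0.
have [<-|cd] := eqVneq c d; first by rewrite commxx lie0r; exact: X1_0.
have [ai|ai] := eqVneq a i; have [bi|bi] := eqVneq b i;
  have [ci|ci] := eqVneq c i; have [di|di] := eqVneq d i;
  try by [exact: avoidingl|exact: avoidingr].
- by rewrite ai bi eqxx in ab.
- by rewrite ai bi eqxx in ab.
- by rewrite ai bi eqxx in ab.
- by rewrite ci di eqxx in cd.
- by rewrite ai ci; exact: both.
- by rewrite ai di (commC _ c) lieNr; apply: X1N => //; exact: both.
- by rewrite ci di eqxx in cd.
- by rewrite bi ci (commC _ a) lieNl; apply: X1N => //; exact: both.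
- rewrite bi di (commC _ a) (commC _ c) lieNl lieNr opprK; exact: both.
Qed.

(** Induction on the length of the word. If d is a or a', or if d does not occur in
    the word, four generators leave room for the indices i and j of the bracket
    lemma, except when the word is a single letter different from a, a' and d.
    Words that contain d reduce to the first case by the Jacobi identity. *)
Lemma reached_with_all p d a a' : p != [::] -> reached_with d a a' p.
Proof.
elim: {p}(size p) {-2}p (erefl (size p)) d a a' => [p /size0nil -> //|N IHN].
case=> // b p [sz_p] d a a' _.
have bracket i j d' e e' f q : e != i -> e' != i -> e != j -> e' != j ->
    i != j -> f != j -> i != d' -> [|| d' != j, q != [::] | f != i] ->
    size q = size p -> reached_with d' e e' (f :: q).
  move=> ei e'i ej e'j ij fj id ok qp; apply: (@reached_with_bracket _ _ _ _ _ i j) => //.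
  have [->|q_neq0] := eqVneq q [::]; first exact: X1_weight4.
  by apply: IHN => //; rewrite qp.
have trivial e d' q : reached_with d' e e q.
  by move=> i _; rewrite commxx act0 lie0r; exact: X1_0.
have head_d d' e f q : size q = size p -> reached_with d' d' e (f :: q).
  have [<- _|de] := eqVneq d' e; first exact: trivial.
  have [j] := fresh_ord (n_ge4 : (size [:: d'; e; f] < n)%N).
  rewrite !inE !negb_or => /and3P[jd je jf].
  have [i] := fresh_ord (n_ge4 : (size [:: d'; e; j] < n)%N).
  rewrite !inE !negb_or => /and3P[id ie ij] qp.
  by apply: (bracket i j); rewrite // 1?eq_sym // jd.
have contains_d d' e e' q : d' \in q -> size q = (size p).+1 -> reached_with d' e e' q.
  move=> dq sz_q; have q_perm := perm_to_rem dq.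
  apply: reached_with_perm (_ : perm_eq (d' :: rem d' q) q) _.
    by rewrite perm_sym.
  have sz : size (rem d' q) = size p by rewrite size_rem // sz_q.
  by apply: reached_with_jacobi; apply: reached_withC; exact: head_d.
have [->|aa'] := eqVneq a a'; first exact: trivial.
have [->|ad] := eqVneq a d; first exact: head_d.
have [->|a'd] := eqVneq a' d; first by apply: reached_withC; exact: head_d.
have [dp|dp] := boolP (d \in b :: p); first by apply: contains_d; rewrite //= sz_p.
have bd : b != d by apply: contraNneq dp => ->; rewrite mem_head.
have use_d i : i != a -> i != a' -> i != d -> (p != [::]) || (b != i) ->
    reached_with d a a' (b :: p).
  move=> ia ia' id ok; apply: (bracket i d); rewrite // ?(eq_sym _ i) //.
  by rewrite eqxx (eq_sym i).
have [i] := fresh_ord (n_ge4 : (size [:: a; a'; d] < n)%N).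
rewrite !inE !negb_or => /and3P[ia ia' id].
have [p0|p_neq0] := eqVneq p [::]; last by apply: (use_d i); rewrite // p_neq0.
have [bi|bi] := eqVneq b i; last by apply: (use_d i); rewrite // bi orbT.
rewrite {}p0 in sz_p head_d contains_d *; subst i.
(* Four distinct letters d, a, a', b are left. Polarization shows that the class
   of F t d a a' b changes sign when two of them are exchanged, whence the
   Jacobi identity reads 3 F = 0. *)
pose F t s e e' f := [lie comm t s, act (comm e e') [:: f]].
have swap_last t s e e' f : t != s -> t != f -> s != f -> e != f -> e' != f ->
    X1 5 t (F t s e e' f + F t f e e' s).
  move=> ts tf sf ef e'f; have [g [dg gy]] := ex_polarization f s.
  have fs : f != s by rewrite eq_sym.
  have ff : reached_with f e e' [:: f] by apply: contains_d; rewrite ?mem_head.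
  have := X1_polarize (isT : 1 < 5)%N fs ts dg gy (ff t tf).
  rewrite (polarize_lie dg gy) !(polarize_comm dg gy) eqxx (negPf tf) (negPf ef).
  rewrite (negPf e'f) /= eqxx !mulr0n !mulr1n !(add0r, addr0) ?(lie0l, lie0r).
  by rewrite ?(add0r, addr0).
have swap_head t s e e' f : t != s -> t != e -> s != e -> e' != e -> f != e ->
    X1 5 t (F t s e e' f + F t e s e' f).
  move=> ts te se e'e fe; have [g [dg gy]] := ex_polarization e s.
  have es : e != s by rewrite eq_sym.
  have := X1_polarize (isT : 1 < 5)%N es ts dg gy (head_d e e' f [::] erefl t te).
  rewrite (polarize_lie dg gy) !(polarize_comm dg gy) eqxx (negPf te) (negPf e'e).
  rewrite /= (negPf fe) !mulr0n !mulr1n !(add0r, addr0) ?(lie0l, lie0r).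
  by rewrite ?(add0r, addr0).
have anti t s e f : t != s -> t != e -> t != f -> s != e -> s != f -> e != f ->
    X1 5 t (F t s e t f + F t s f t e).
  move=> ts te tf se sf ef; have ft : f != t by rewrite eq_sym.
  rewrite (_ : _ + _ = (F t s e t f + F t f e t s)
      - (F t f e t s + F t e f t s) + (F t s f t e + F t e f t s)); last by zmodule.
  by apply: X1D => //; [apply: X1B => //|]; [apply: swap_last|apply: swap_head|
    apply: swap_last]; rewrite // eq_sym.
have a'_a : a' != a by rewrite eq_sym.
have da' : d != a' by rewrite eq_sym.
have Fx1 : X1 5 a' (F a' d a a' b + F a' d b a' a).
  by apply: anti; rewrite // eq_sym.
have Fx2 : X1 5 a' (F a' d a a' b + F a' d a b a').
  have move e e' f :
      X 5 (single a (F a d e e' f) - single a' (F a' d e e' f)).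
    exact: (X_move_index e e' [:: f]).
  have Fa : X1 5 a (F a d a' a b + F a d b a a').
    by apply: anti; rewrite // eq_sym.
  rewrite /F (commC _ a a') (commC _ a b) !actN !lieNr -opprD.
  apply: X1N => //; rewrite /X1 singleD -!/(F _ _ _ _ _).
  rewrite (_ : _ + _ = single a (F a d a' a b + F a d b a a')
    - (single a (F a d a' a b) - single a' (F a' d a' a b))
    - (single a (F a d b a a') - single a' (F a' d b a a'))).
    by apply: XB => //; apply: XB => //.
  by rewrite singleD; zmodule.
apply: (@reached_with_any a') => //; apply: (@X1_divn _ _ _ 3) => //.
rewrite (_ : _ *+ 3 = (F a' d a a' b + F a' d b a' a) + (F a' d a a' b + F a' d a b a')).
  exact: X1D.
have -> : [lie comm a' d, act (comm a a') [:: b]] = F a' d a b a' + F a' d b a' a.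
  by rewrite comm_jacobi lieBr (commC _ a' b) actN lieNr opprK.
have -> : F a' d a a' b = F a' d a b a' + F a' d b a' a.
  by rewrite /F comm_jacobi lieBr (commC _ a' b) actN lieNr opprK.
by zmodule.
Qed.

(** There is no obstruction in the second derived algebra; consequently letters
    may be reordered freely in the remaining leading terms. *)
Lemma X1_lie_comm i a b c d p : X1 (4 + size p) i [lie comm a b, act (comm c d) p].
Proof.
have [->|p_neq0] := eqVneq p [::]; first exact: X1_weight4.
have [ai|ai] := eqVneq a i; have [bi|bi] := eqVneq b i.
- by rewrite ai bi commxx lie0l; exact: X1_0.
- by rewrite ai; apply: reached_with_all => //; rewrite eq_sym.
- rewrite bi commC lieNl; apply: X1N => //.
  by apply: reached_with_all => //; rewrite eq_sym.
exact: X1_avoiding.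
Qed.

(** * The leading terms modulo the second derived algebra *)

Lemma X1_act_lie N i a b c d p1 p2 p3 :
  N = (4 + size p1 + size p2 + size p3)%N ->
  X1 N i (act [lie act (comm a b) p1, act (comm c d) p2] p3).
Proof.
have right_word N' a' b' c' d' q r : (0 < size q)%N -> N' = (4 + size q + size r)%N ->
    X1 N' i (act [lie comm a' b', act (comm c' d') q] r).
  move=> q_gt0 ->; rewrite (act_lie y laws r (comm_gamma y a' b')).
    rewrite -act_cat -addnA -size_cat; exact: X1_lie_comm.
  by apply: (@gamma_le _ _ 3 (2 + size q)); [|exact: gamma_comm_act].
have left_word N' a' b' c' d' q r : (0 < size q)%N -> N' = (4 + size q + size r)%N ->
    X1 N' i (act [lie act (comm a' b') q, comm c' d'] r).
  move=> q_gt0 NE; rewrite lieC actN; apply: X1N; first by rewrite NE.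
  exact: right_word.
case: p1 p2 => [|e p1] [|f p2] NE.
- case: p3 NE => [|e p3] NE.
    by rewrite NE; exact: (X1_lie_comm i a b c d [::]).
  rewrite [act _ _]/= lie_leibniz actD; apply: X1D; first by rewrite NE.
    by apply: (left_word _ a b c d [:: e]); rewrite // NE /= addnA.
  by apply: (right_word _ a b c d [:: e]); rewrite // NE /= addnA.
- by apply: right_word; rewrite // NE addn0.
- by apply: left_word; rewrite // NE addn0.
rewrite laws.2 ?act0; first exact: X1_0.
  by apply: (@gamma_le _ _ 3 (2 + size (e :: p1))); last exact: gamma_comm_act.
by apply: (@gamma_le _ _ 3 (2 + size (f :: p2))); last exact: gamma_comm_act.
Qed.

Lemma X1_perm_diff i a b p q : perm_eq p q ->
  X1 (2 + size p) i (act (comm a b) p - act (comm a b) q).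
Proof.
move=> pq; have N1 : (1 < 2 + size p)%N by [].
apply: act_perm pq => [u v||p1 k l p2 sz]; [exact: X1D|exact: X1_0|].
rewrite act_swap; apply: X1N => //.
apply: (@X1_act_lie _ i k l a b [::] p1 p2); rewrite -sz size_cat /=; lia.
Qed.

Lemma X1_perm i a b p q : perm_eq p q ->
  X1 (2 + size p) i (act (comm a b) p) -> X1 (2 + size q) i (act (comm a b) q).
Proof.
move=> pq Xp; rewrite -(perm_size pq) -[act _ q](subKr (act (comm a b) p)).
by apply: X1B => //; exact: X1_perm_diff.
Qed.

(** Replacing a letter of a word by an element of the derived algebra gives an
    element of the second derived algebra, unless the letter is in the leading
    commutator. *)
Lemma X1_der_act N i j a b c e p r d : derivation d ->
  (forall k, d (y k) = single j (act (comm c e) r) k) ->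
  N = (3 + size p + size r)%N ->
  X1 N i (d (act (comm a b) p) - act (d (comm a b)) p).
Proof.
move=> dd dy NE; have N1 : (1 < N)%N by rewrite NE.
apply: (der_act dd (S := X1 N i)) => [u v||p1 k p2 pE]; [exact: X1D|exact: X1_0|].
rewrite dy /single; have [_|_] := eqVneq k j; last first.
  by rewrite lie0r act0; exact: X1_0.
by apply: X1_act_lie; rewrite NE pE size_cat /=; lia.
Qed.

(** The bracket of f d/dy_i, f = [y_j, y_d] m, with g d/dy_j, g = [y_a, y_b] m',
    where m collects the letters of q other than i and m' those equal to i. *)
Lemma X1_insert i j a b d q : a != i -> b != i -> d != i ->
  j \notin [:: i; a; b; d] -> X1 (2 + size (d :: q)) i (act (comm a b) (d :: q)).
Proof.
rewrite !inE !negb_or => ai bi di /and4P[ji ja jb jd].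
set m := [seq z <- q | z != i]; set m' := nseq (count_mem i q) i.
have q_perm : perm_eq q (m' ++ m) := perm_gather i q.
have sz : size q = (size m' + size m)%N by rewrite (perm_size q_perm) size_cat.
have Xf : X1 (2 + size m) i (act (comm j d) m).
  apply: X_elementary; last exact: gamma_comm_act.
  by apply: avoid_act; [exact: avoid_comm|rewrite mem_filter eqxx].
have ag : avoid j (act (comm a b) m').
  apply: avoid_act; first by apply: avoid_comm; rewrite eq_sym.
  by apply/negP => /nseqP[/eqP]; rewrite (negPf ji).
have [d1 [dd1 d1y]] := derR (single j (act (comm a b) m')).
have [d2 [dd2 d2y]] := derR (single i (act (comm j d) m)).
have ij : i != j by rewrite eq_sym.
have := X_bracket (isT : 1 < 2 + size m)%N (isT : 1 < 2 + size m')%N ij ag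
  (@gamma_comm_act a b m') Xf dd1 d1y dd2 d2y.
set N := (_ + _).-1; have NE : N = (3 + size m + size m')%N by rewrite /N addnCA.
have N1 : (1 < N)%N by rewrite NE.
have d2ab : d2 (comm a b) = 0.
  by rewrite (der_comm y dd2) !d2y /single (negPf ai) (negPf bi) lie0l lie0r addr0.
have := X1_der_act j a b dd2 d2y (_ : N = 3 + size m' + size m)%N.
rewrite d2ab act0 subr0 => /(_ _) Xj; rewrite /X1 in Xj.
have {}Xj := Xj (etrans NE (addnAC _ _ _)) => Xij.
have {Xij Xj}Xi : X1 N i (d1 (act (comm j d) m)).
  by have := XD N1 Xij Xj; rewrite subrK.
have Xd1 := X1_der_act i j d dd1 d1y NE.
have := X1B N1 Xi Xd1; rewrite subKr (der_comm y dd1) !d1y /single eqxx.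
rewrite [d == j]eq_sym (negPf jd) lie0r addr0.
rewrite (_ : act _ m = act (comm a b) (m' ++ d :: m)); last by rewrite act_cat.
move=> Xm; apply: (@X1_perm _ _ _ (m' ++ d :: m)).
  by rewrite perm_sym -[d :: m]cat1s perm_sym perm_catCA /= perm_cons perm_sym.
by rewrite (_ : 2 + _ = N)%N // NE size_cat /= addnS [(size m' + _)%N]addnC.
Qed.

(** This is the bracket of [y_j, y_b] d/dy_i with [y_i, y_a] d/dy_j. *)
Lemma X_bracket_weight3 i j a b : uniq [:: i; j; a; b] ->
  X 3 (single i [lie comm i a, y b] - single j [lie comm j b, y a]).
Proof.
rewrite /= !inE !negb_or => /and4P[/and3P[ij ia ib] /andP[ja jb] ab _].
have Xf : X1 2 i (comm j b).
  by apply: X_elementary; [apply: avoid_comm; rewrite eq_sym|exact: comm_gamma].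
have ag : avoid j (comm i a) by apply: avoid_comm; rewrite // eq_sym.
have [d1 [dd1 d1y]] := derR (single j (comm i a)).
have [d2 [dd2 d2y]] := derR (single i (comm j b)).
have := X_bracket (isT : 1 < 2)%N (isT : 1 < 2)%N ij ag
  (comm_gamma y i a) Xf dd1 d1y dd2 d2y.
rewrite (der_comm y dd1) (der_comm y dd2) !d1y !d2y /single !eqxx.
rewrite (eq_sym b) (negPf jb) (eq_sym a) (negPf ia).
by rewrite !lie0r !addr0.
Qed.

Lemma X1_tame i a b p : a != i -> b != i -> i \notin p ->
  X1 (2 + size p) i (act (comm a b) p).
Proof.
move=> ai bi ip; apply: X_elementary; last exact: gamma_comm_act.
by apply: avoid_act => //; exact: avoid_comm.
Qed.

Lemma X1_repeated i a b d q : a != i -> b != i -> d \in [:: a; b] -> d \in q ->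
  X1 (2 + size q) i (act (comm a b) q).
Proof.
move=> ai bi d_ab dq; have [j j_out] := fresh_ord (n_ge4 : (size [:: i; a; b] < n)%N).
apply: X1_perm (_ : perm_eq (d :: rem d q) q) _.
  by rewrite perm_sym; exact: perm_to_rem.
apply: (@X1_insert _ j) => //.
  by move: d_ab; rewrite !inE => /orP[] /eqP ->.
move: d_ab j_out; rewrite !inE.
by move=> /orP[] /eqP ->; rewrite !negb_or => /and3P[-> -> ->].
Qed.

(** If d does not occur in the commutator, polarizing y_a to y_d, and y_b to
    y_d, in words with a repeated letter shows that the Jacobi sum of
    [y_a, y_b] y_d is three times its first term. *)
Lemma X1_other i a b d q : a != i -> b != i -> d != i -> d \in q ->
  X1 (2 + size q) i (act (comm a b) q).
Proof.
move=> ai bi di dq; have [<-|ab] := eqVneq a b.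
  by rewrite commxx act0; exact: X1_0.
have [aq|aq] := boolP (a \in q).
  by apply: (@X1_repeated i a b a); rewrite ?mem_head.
have [bq|bq] := boolP (b \in q); first by apply: (@X1_repeated i a b b); rewrite ?inE ?eqxx ?orbT.
have da : a != d by apply: contraNneq aq => ->.
have db : b != d by apply: contraNneq bq => ->.
apply: X1_perm (_ : perm_eq (d :: rem d q) q) _.
  by rewrite perm_sym; exact: perm_to_rem.
have id : i != d by rewrite eq_sym.
set r := rem d q; have ar : a \notin r by apply: contra aq; exact: mem_rem.
have br : b \notin r by apply: contra bq; exact: mem_rem.
have polarized k : k \in [:: a; b] -> k != d -> k \notin r -> exists g, 
    [/\ derivation g, forall j, g (y j) = single k (y d) j
    & X1 (2 + size (d :: r)) i (act (g [lie comm a b, y k]) r)].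
  move=> k_ab kd kr; have [g [dg gy]] := ex_polarization k d.
  exists g; split=> //; have ki : k != i by move: k_ab; rewrite !inE => /orP[] /eqP ->.
  have := X1_polarize (isT : 1 < 2 + size (k :: r))%N kd id dg gy
    (@X1_repeated i a b k (k :: r) ai bi k_ab (mem_head _ _)).
  rewrite [act _ _]/= der_act_const // => l lr.
  by rewrite gy /single; case: eqP lr kr => // -> ->.
have [g1 [dg1 g1y]] := polarized a (mem_head _ _) da ar.
have b_in : b \in [:: a; b] by rewrite !inE eqxx orbT.
have [g2 [dg2 g2y]] := polarized b b_in db br.
rewrite (der_lie dg1) (der_lie dg2) (polarize_comm dg1 g1y) (polarize_comm dg2 g2y).
rewrite g1y g2y /single !eqxx (negPf ab) (eq_sym b) (negPf ab).
rewrite !mulr1n !mulr0n addr0 add0r => X1g X2g.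
apply: (@X1_divn _ _ _ 3) => //; have := X1D (isT : 1 < 2 + size (d :: r))%N X1g X2g.
rewrite -actD; congr (X1 _ _ _); rewrite !actD.
rewrite -[act [lie comm d b, y a] r]/(act (comm d b) (a :: r)).
rewrite -[act [lie comm a d, y b] r]/(act (comm a d) (b :: r)).
rewrite -[act [lie comm a b, y d] r]/(act (comm a b) (d :: r)).
rewrite [act (comm a b) _]comm_jacobi (commC _ d b) actN.
by zmodule.
Qed.

(** The derivation [y_a, y_b] p d/dy_i with a and b different from i has trace
    zero, even when y_i occurs in p. *)
Lemma X1_traceless i a b p : a != i -> b != i ->
  X1 (2 + size p) i (act (comm a b) p).
Proof.
move=> ai bi; have [<-|ab] := eqVneq a b.
  by rewrite commxx act0; exact: X1_0.
have ia : i != a by rewrite eq_sym.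
have ib : i != b by rewrite eq_sym.
have N1 : (1 < 2 + size p)%N by [].
have [all_i|] := boolP (all (pred1 i) p); last first.
  by move=> /allPn[d dp di]; exact: (@X1_other _ _ _ d).
have [j] := fresh_ord (n_ge4 : (size [:: i; a; b] < n)%N).
rewrite !inE !negb_or => /and3P[ji ja jb].
have ij : i != j by rewrite eq_sym.
have aj : a != j by rewrite eq_sym.
have bj : b != j by rewrite eq_sym.
(* a power of y_i: polarize a word over a fourth letter j *)
have polarized k l q : k != l -> a != k -> b != k -> a != l -> b != l ->
    l \notin q -> exists2 g, derivation g /\ (forall j, g (y j) = single k (y l) j)
    & X (2 + size q) (single l (g (act (comm a b) q)) - single k (act (comm a b) q)).
  move=> kl ak bk al bl lq; have [g [dg gy]] := ex_polarization k l; exists g => //.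
  by apply: (X_polarize_eq _ kl dg gy) => //; exact: X1_tame.
have jp : j \notin p.
  apply: contraL all_i => jp; apply/allPn; exists j => //.
have [g [dg gy] Xg] := polarized i j p ij ai bi aj bj jp.
have g_ab : g (comm a b) = 0.
  by rewrite (polarize_comm dg gy) (negPf ai) (negPf bi) !mulr0n addr0.
case: p => [|k [|l p]] in N1 all_i jp Xg *.
- exact: X1_tame.
- move: all_i; rewrite /= andbT => /eqP kE; rewrite {}kE in Xg *.
  have distinct : uniq [:: i; j; a; b] by rewrite /= !inE !negb_or ij ia ib ja jb ab.
  have distinct' : uniq [:: i; j; b; a].
    by rewrite /= !inE !negb_or ij ia ib ja jb eq_sym ab.
  have := XB (isT : 1 < 3)%N (X_bracket_weight3 distinct') (X_bracket_weight3 distinct).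
  rewrite [act _ [:: i]]/= (der_lie dg) g_ab gy /single eqxx lie0l add0r -!/(single _ _) in Xg *.
  move=> Xsum; apply: (@X_divn _ _ 2) => //.
  move: (XB (isT : 1 < 3)%N Xsum Xg); congr (X 3 _).
  have jac t : [lie comm a b, y t] = [lie comm t b, y a] - [lie comm t a, y b].
    have := comm_jacobi y a b t [::]; rewrite /= => ->.
    by rewrite (commC _ a) (commC _ b) !lieNl opprK addrC.
  by rewrite !jac !singleB; zmodule.
- rewrite /X1 -[single i _](subKr (single j (g (act (comm a b) [:: k, l & p])))).
  apply: XB => //.
  have Xj : X1 (2 + size [:: k, l & p]) j (g (act (comm a b) [:: k, l & p])
      - act (g (comm a b)) [:: k, l & p]).
    apply: der_act => // [u v||p1 e p2 pE]; [exact: X1D|exact: X1_0|].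
    rewrite gy /single; have [_|_] := eqVneq e i; last first.
      by rewrite lie0r act0; exact: X1_0.
    rewrite -[act [lie _, _] p2]/(act (act (comm a b) p1) (j :: p2)) -act_cat.
    have sz : size [:: k, l & p] = size (p1 ++ j :: p2) by rewrite pE !size_cat.
    rewrite sz; apply: (@X1_other _ _ _ i) => //.
    have all_p : all (pred1 i) (p1 ++ p2).
      by move: all_i; rewrite pE !all_cat /= => /and3P[-> _ ->].
    have : (0 < size (p1 ++ p2))%N.
      by rewrite size_cat; move: sz; rewrite size_cat /= addnS => -[<-].
    rewrite mem_cat inE orbCA -mem_cat.
    case: (p1 ++ p2) all_p => //= t r /andP[/eqP -> _] _.
    by rewrite mem_head orbT.
  by rewrite g_ab act0 subr0 in Xj.
Qed.

(** The class of [y_i, y_a] p d/dy_i only depends on the monomial y_a p, which is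
    its trace. *)
Lemma X_switch_index i j a p : i != a -> j != a ->
  X (2 + size p) (single i (act (comm i a) p) - single j (act (comm j a) p)).
Proof.
have [<- _ _|ij ia ja] := eqVneq i j; first by rewrite subrr.
have N1 : (1 < 2 + size p)%N by [].
have ji : j != i by rewrite eq_sym.
have ai : a != i by rewrite eq_sym.
have [g [dg gy]] := ex_polarization j i.
have := X_polarize_eq N1 ji dg gy (X1_traceless p ji ai).
set f := act (comm j a) p => Xg.
have Xi : X1 (2 + size p) i (g f - act (comm i a) p).
  have <- : g (comm j a) = comm i a.
    by rewrite (polarize_comm dg gy) eqxx (eq_sym a) (negPf ja) mulr1n addr0.
  apply: der_act => // [u v||p1 e p2 pE]; [exact: X1D|exact: X1_0|].
  rewrite gy /single; have [_|_] := eqVneq e j; last first.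
    by rewrite lie0r act0; exact: X1_0.
  rewrite -[act [lie _, _] p2]/(act (act (comm j a) p1) (i :: p2)) -act_cat.
  have -> : size p = size (p1 ++ i :: p2) by rewrite pE !size_cat.
  exact: X1_traceless.
rewrite (_ : _ - _ = (single i (g f) - single j f) - single i (g f - act (comm i a) p)).
  exact: XB.
by rewrite singleB; zmodule.
Qed.

(** By the Jacobi identity the difference is a derivation of trace zero. *)
Lemma X_switch_letters i a b p : a != i -> b != i ->
  X1 (3 + size p) i (act (comm i a) (b :: p) - act (comm i b) (a :: p)).
Proof.
move=> ai bi; rewrite (comm_jacobi y i a) [X in X1 _ _ (X - _)]addrC addrK.
by apply: X1N => //; exact: (X1_traceless (i :: p)).
Qed.

(** Moving the derivative to an index k outside the two leading letters allows to
    exchange these letters. *)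
Lemma X_monomial i j a b p q : i != a -> j != b -> perm_eq (a :: p) (b :: q) ->
  X (2 + size p) (single i (act (comm i a) p) - single j (act (comm j b) q)).
Proof.
move=> ia jb pq.
have N1 : (1 < 2 + size p)%N by [].
have Xtrans (u v w : 'I_n -> R) :
    X (2 + size p) (u - v) -> X (2 + size p) (v - w) -> X (2 + size p) (u - w).
  by move=> uv vw; rewrite -[_ - _](subrKA v); exact: XD.
have Xperm k c r1 r2 : size r1 = size p -> perm_eq r1 r2 ->
    X (2 + size p) (single k (act (comm k c) r1) - single k (act (comm k c) r2)).
  move=> <- r12; rewrite -singleB; exact: X1_perm_diff.
have sz : size q = size p by have [] := perm_size pq.
have [ab|ab] := eqVneq a b.
  move: pq; rewrite ab perm_cons => pq; rewrite ab in ia *.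
  apply: (Xtrans _ (single j (act (comm j b) p))); first exact: X_switch_index.
  exact: Xperm.
have [k] := fresh_ord (ltnW n_ge4 : (size [:: a; b] < n)%N).
rewrite !inE negb_or => /andP[ka kb].
have bp : b \in p.
  by have := perm_mem pq b; rewrite mem_head inE eq_sym (negPf ab).
have pE := perm_to_rem bp; set r := rem b p in pE.
have qE : perm_eq (a :: r) q.
  rewrite -(perm_cons b); apply: perm_trans pq.
  apply: (perm_trans (y := [:: a, b & r])).
    by rewrite (perm_catCA [:: b] [:: a] r).
  by rewrite perm_cons perm_sym.
apply: (Xtrans _ (single k (act (comm k a) p))); first exact: X_switch_index.
apply: (Xtrans _ (single k (act (comm k a) (b :: r)))); first exact: Xperm.
apply: (Xtrans _ (single k (act (comm k b) (a :: r)))).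
  rewrite -singleB (perm_size pE); apply: X_switch_letters; rewrite eq_sym //.
apply: (Xtrans _ (single k (act (comm k b) q))).
  by apply: Xperm; rewrite // -sz (perm_size qE).
by rewrite -sz; exact: X_switch_index.
Qed.

End LeadingTerms.
(** * The Magnus embedding and the trace *)

Section DegreeFiltration.
Variables (K : fieldType) (n : nat).
Implicit Types p q : {mpoly K[n]}.

Definition order_ge (k : nat) p : Prop := forall m, (mdeg m < k)%N -> p@_m = 0.

Lemma order_ge0 p : order_ge 0 p.
Proof. by []. Qed.

Lemma order_ge_0 k : order_ge k 0.
Proof. by move=> m _; rewrite mcoeff0. Qed.

Lemma order_geD k p q : order_ge k p -> order_ge k q -> order_ge k (p + q).
Proof. by move=> kp kq m mk; rewrite mcoeffD kp // kq // addr0. Qed.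

Lemma order_geN k p : order_ge k p -> order_ge k (- p).
Proof. by move=> kp m mk; rewrite mcoeffN kp // oppr0. Qed.

Lemma order_geB k p q : order_ge k p -> order_ge k q -> order_ge k (p - q).
Proof. by move=> kp /order_geN; exact: order_geD. Qed.

Lemma order_geZ k a p : order_ge k p -> order_ge k (a *: p).
Proof. by move=> kp m mk; rewrite mcoeffZ kp // mulr0. Qed.

Lemma order_ge_sum k (I : Type) (r : seq I) (P : pred I) (F : I -> {mpoly K[n]}) :
  (forall i, P i -> order_ge k (F i)) -> order_ge k (\sum_(i <- r | P i) F i).
Proof. by apply: big_ind; [exact: order_ge_0|move=> *; exact: order_geD]. Qed.

Lemma order_geM k l p q : order_ge k p -> order_ge l q -> order_ge (k + l) (p * q).
Proof.
move=> kp lq m mkl; rewrite mcoeffM big1 // => -[m1 m2] /= /eqP mE.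
have [m1k|km1] := ltnP (mdeg m1) k; first by rewrite kp // mul0r.
rewrite [X in _ * X]lq ?mulr0 //; have mdegE := congr1 (@mdeg n) mE.
rewrite mdegE mdegD in mkl; rewrite -(ltn_add2l k); apply: leq_ltn_trans mkl.
by rewrite leq_add2r.
Qed.

Lemma order_geX i : order_ge 1 ('X_i : {mpoly K[n]}).
Proof.
move=> m; rewrite ltnS leqn0 mdeg_eq0 => /eqP ->; rewrite mcoeffX.
by rewrite -mdeg_eq0 mdeg1.
Qed.

(** A non-identity permutation moves at least two indices, so it contributes a
    product with two off-diagonal factors. *)
Lemma det_order e (B : 'M[{mpoly K[n]}]_n) : (0 < e)%N ->
  (forall i j, order_ge e (B i j)) ->
  order_ge (e + e) (\det (1%:M + B) - (1 + \tr B)).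
Proof.
move=> e_gt0 eB.
have diag (r : seq 'I_n) : order_ge e (\prod_(i <- r) (1 + B i i) - 1) /\
    order_ge (e + e) (\prod_(i <- r) (1 + B i i) - (1 + \sum_(i <- r) B i i)).
  elim: r => [|i r [IH1 IH2]].
    by rewrite !big_nil addr0 subrr; split; exact: order_ge_0.
  rewrite !big_cons; set P := \prod_(_ <- _) _ in IH1 IH2 *; set S := \sum_(_ <- _) _ in IH2 *.
  split.
    rewrite (_ : _ - 1 = (P - 1) + B i i * P); last by rewrite mulrDl mul1r addrAC.
    by apply: order_geD => //; rewrite -[e]addn0; exact: order_geM.
  rewrite (_ : _ - _ = (P - (1 + S)) + B i i * (P - 1)).
    by apply: order_geD => //; exact: order_geM.
  by rewrite mulrDl mul1r mulrBr mulr1; zmodule.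
rewrite /determinant (bigD1 (1%g : 'S_n)) //= odd_perm1 expr0 mul1r.
rewrite (_ : _ - _ = (\prod_i (1 + B i i) - (1 + \sum_i B i i)) + 
   \sum_(s : 'S_n | s != 1%g) (-1) ^+ s * \prod_i (1%:M + B)%R i (s i)); last first.
  rewrite addrAC; congr (_ - _ + _); apply: eq_bigr => i _.
  by rewrite perm1 !mxE eqxx.
apply: order_geD; first exact: (diag _).2.
apply: order_ge_sum => s s_neq1.
have [i si] : exists i, s i != i.
  apply/existsP; apply: contraR s_neq1; rewrite negb_exists => /forallP fix_s.
  by apply/eqP/permP => i; rewrite perm1; apply/eqP; move: (fix_s i); rewrite negbK.
have ssi : s (s i) != s i by apply: contra si => /eqP/perm_inj ->.
rewrite (bigD1 i) //= (bigD1 (s i)) //= !mxE.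
rewrite eq_sym (negPf si) [s i == _]eq_sym (negPf ssi) !add0r.
apply: (@order_geM 0 (e + e)); first exact: order_ge0.
apply: (@order_geM e e) => //; rewrite -[e]addn0.
by apply: order_geM => //; exact: order_ge0.
Qed.

Lemma unit_coef p m : p \is a GRing.unit -> m != 0%MM -> p@_m = 0.
Proof.
by case/andP=> /eqP -> _ m0; rewrite mcoeffC (negPf m0) mulr0.
Qed.

End DegreeFiltration.

Section MagnusAlgebra.
Variables (K : fieldType) (n : nat).
Local Notation A := {mpoly K[n]}.

(** The semidirect product of the abelian Lie algebra A and the free A-module
    with basis indexed by 'I_n, on which it acts by multiplication. *)
Definition magnus : Type := (A * ('I_n -> A))%type.

HB.instance Definition _ := GRing.Lmodule.copy magnus (A * ('I_n -> A))%type.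

Definition magnus_bracket (u v : magnus) : magnus :=
  (0, fun k => v.1 * u.2 k - u.1 * v.2 k).

Fact magnus_linearl (v : magnus) : linear (magnus_bracket^~ v).
Proof.
move=> a u w; congr pair; first by rewrite /= scaler0 addr0.
apply/funext => k.
rewrite -[LHS]/(v.1 * (a *: u.2 k + w.2 k) - (a *: u.1 + w.1) * v.2 k).
rewrite -[RHS]/(a *: (v.1 * u.2 k - u.1 * v.2 k) + (v.1 * w.2 k - w.1 * v.2 k)).
by rewrite !(mulrDr, mulrDl, scalerBr) -!(scalerAl, scalerAr); zmodule.
Qed.

Fact magnus_linearr (u : magnus) : linear (magnus_bracket u).
Proof.
move=> a v w; congr pair; first by rewrite /= scaler0 addr0.
apply/funext => k.
rewrite -[LHS]/((a *: v.1 + w.1) * u.2 k - u.1 * (a *: v.2 k + w.2 k)).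
rewrite -[RHS]/(a *: (v.1 * u.2 k - u.1 * v.2 k) + (w.1 * u.2 k - u.1 * w.2 k)).
by rewrite !(mulrDr, mulrDl, scalerBr) -!(scalerAl, scalerAr); zmodule.
Qed.

Fact magnus_bracketxx (u : magnus) : magnus_bracket u u = 0.
Proof. by congr pair; apply/funext => k; rewrite /= subrr. Qed.

Fact magnus_jacobi (u v w : magnus) :
  magnus_bracket u (magnus_bracket v w) + magnus_bracket v (magnus_bracket w u)
    + magnus_bracket w (magnus_bracket u v) = 0.
Proof.
congr pair; first by rewrite /= !addr0.
apply/funext => k; rewrite -[RHS]/(0 : A).
rewrite -[LHS]/((0 * u.2 k - u.1 * (w.1 * v.2 k - v.1 * w.2 k))
  + (0 * v.2 k - v.1 * (u.1 * w.2 k - w.1 * u.2 k))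
  + (0 * w.2 k - w.1 * (v.1 * u.2 k - u.1 * v.2 k))).
rewrite !mul0r !mulrBr !mulrA (mulrC v.1 u.1) (mulrC w.1 u.1) (mulrC w.1 v.1).
by zmodule.
Qed.

HB.instance Definition _ := Lmodule_isLieAlgebra.Build K magnus
  magnus_linearl magnus_linearr magnus_bracketxx magnus_jacobi.

Lemma gamma2_magnus (u : magnus) : gamma magnus 2 u -> u.1 = 0.
Proof.
move: u; apply: gamma_ind => // ; split=> // a u v /= u1 v1.
by rewrite u1 v1 scaler0 addr0.
Qed.

Lemma magnus_laws : variety_laws magnus.
Proof.
have comm0 (u v : magnus) : gamma magnus 2 u -> gamma magnus 2 v -> [lie u, v] = 0.
  move=> /gamma2_magnus u1 /gamma2_magnus v1; congr pair; apply/funext => k.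
  by rewrite u1 v1 !mul0r subrr.
split=> [u v w u2 v2 w2|u v u3 v3]; first by rewrite (comm0 u v) // lie0l.
by apply: comm0; apply: (@gamma_le _ _ 2 3).
Qed.

Definition magnus_gen (i : 'I_n) : magnus := ('X_i, fun k => (k == i)%:R).

End MagnusAlgebra.

Section Trace.
Variables (K : fieldType) (n : nat) (R : lieAlgType K) (y : 'I_n -> R).
Hypothesis genR : forall S : set R, is_subspace S ->
  (forall u v, S u -> S v -> S [lie u, v]) -> (forall i, S (y i)) ->
  forall r, S r.
Variable mu : R -> magnus K n.
Hypothesis mu_hom : lie_hom mu.
Hypothesis mu_gen : forall i, mu (y i) = magnus_gen K i.

(** The analogue of the k-th Fox derivative. *)
Definition fox (k : 'I_n) (r : R) : {mpoly K[n]} := (mu r).2 k.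

Lemma foxD k r s : fox k (r + s) = fox k r + fox k s.
Proof. by rewrite /fox (homD mu_hom). Qed.

Lemma foxZ k a r : fox k (a *: r) = a *: fox k r.
Proof. by rewrite /fox (homZ mu_hom). Qed.

Lemma fox0 k : fox k 0 = 0.
Proof. by rewrite /fox (hom0 mu_hom). Qed.

Lemma foxB k r s : fox k (r - s) = fox k r - fox k s.
Proof. by rewrite /fox (homB mu_hom). Qed.

Lemma fox_lie k r s : fox k [lie r, s] = (mu s).1 * fox k r - (mu r).1 * fox k s.
Proof. by rewrite /fox (hom_lie mu_hom). Qed.

Lemma fox_gen k i : fox k (y i) = (k == i)%:R.
Proof. by rewrite /fox mu_gen. Qed.

Lemma gamma2_mu r : gamma R 2 r -> (mu r).1 = 0.
Proof. by move=> r2; apply: gamma2_magnus; exact: gamma_hom. Qed.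

Lemma mu1_order r : order_ge 1 (mu r).1.
Proof.
move: r; apply: (genR (S := fun r => order_ge 1 (mu r).1)) => [|u v _ _|i].
- split=> [|a u v u1 v1]; first by rewrite (hom0 mu_hom); exact: order_ge_0.
  by rewrite (homD mu_hom) (homZ mu_hom); apply: order_geD => //; exact: order_geZ.
- by rewrite (hom_lie mu_hom); exact: order_ge_0.
- by rewrite mu_gen; exact: order_geX.
Qed.

Lemma fox_order k c r : gamma R c.+1 r -> order_ge c (fox k r).
Proof.
elim: c r => [//|c IHc].
apply: (gamma_ind (S := fun r => order_ge c.+1 (fox k r))).
  split=> [|a u v uo vo]; first by rewrite fox0; exact: order_ge_0.
  by rewrite foxD foxZ; apply: order_geD => //; exact: order_geZ.
move=> u v cu; rewrite fox_lie; apply: order_geB.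
  by rewrite -add1n; apply: order_geM; [exact: mu1_order|exact: IHc].
case: c cu {IHc} => [|c] cu.
  by rewrite -[1%N]addn0; apply: order_geM; [exact: mu1_order|].
rewrite gamma2_mu ?mul0r; first exact: order_ge_0.
exact: (gamma_le (isT : 2 <= c.+2)%N).
Qed.

Lemma fox_act k a b p :
  fox k (act y (comm y a b) p) =
    ((k == a)%:R * 'X_b - (k == b)%:R * 'X_a) * \prod_(j <- p) 'X_j.
Proof.
have act_fox w q : (mu w).1 = 0 -> fox k (act y w q) = fox k w * \prod_(j <- q) 'X_j.
  elim: q w => [|j q IHq] w w1; first by rewrite big_nil mulr1.
  rewrite big_cons mulrA [fox k w * _]mulrC /= IHq; last by rewrite (hom_lie mu_hom).
  by rewrite fox_lie w1 mul0r subr0 mu_gen.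
rewrite act_fox; last exact: (gamma2_mu (comm_gamma y a b)).
rewrite fox_lie !fox_gen !mu_gen /=; congr ((_ - _) * _); exact: mulrC.
Qed.

(** Both sides of the chain rule are determined by their values at the generators,
    because f induces the identity modulo the derived algebra. *)
Lemma fox_chain (f : R -> R) k r : lie_hom f ->
    (forall i, gamma R 2 (f (y i) - y i)) ->
  fox k (f r) = \sum_i fox i r * fox k (f (y i)).
Proof.
move=> fh fy; have f_mod s : (mu (f s)).1 = (mu s).1.
  have : gamma R (2 + 0) (f s - s) by exact: (hom_diff genR fh (@lie_hom_id _ _) fy).
  by move=> /gamma2_mu; rewrite (homB mu_hom) => /eqP; rewrite subr_eq0 => /eqP.
move: r; apply: (genR (S := fun r => fox k (f r) = \sum_i fox i r * fox k (f (y i)))).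
- split=> [|a u v fu fv].
    by rewrite (hom0 fh) fox0 big1 // => i _; rewrite fox0 mul0r.
  rewrite (homD fh) (homZ fh) foxD foxZ fu fv scaler_sumr -big_split /=.
  by apply: eq_bigr => i _; rewrite foxD foxZ mulrDl scalerAl.
- move=> u v fu fv; rewrite (hom_lie fh) fox_lie !f_mod fu fv !mulr_sumr -sumrB.
  by apply: eq_bigr => i _; rewrite fox_lie mulrBl !mulrA.
- move=> i; rewrite (bigD1 i) //= fox_gen eqxx mul1r big1 ?addr0 // => j /negPf ji.
  by rewrite fox_gen ji mul0r.
Qed.

Definition trace (u : 'I_n -> R) : {mpoly K[n]} := \sum_i fox i (u i).

Lemma traceD u v : trace (u + v) = trace u + trace v.
Proof. by rewrite /trace -big_split; apply: eq_bigr => i _; exact: foxD. Qed.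

Lemma traceZ a u : trace (a *: u) = a *: trace u.
Proof. by rewrite /trace scaler_sumr; apply: eq_bigr => i _; exact: foxZ. Qed.

Lemma trace_order c u : (forall i, gamma R c.+1 (u i)) -> order_ge c (trace u).
Proof. by move=> cu; apply: order_ge_sum => i _; exact: fox_order. Qed.

Lemma trace_single i r : trace (single i r) = fox i r.
Proof.
rewrite /trace (bigD1 i) //= /single eqxx big1 ?addr0 // => j /negPf ->.
exact: fox0.
Qed.

(** By the chain rule the Jacobian matrix of an automorphism is invertible over
    a polynomial ring, so its determinant is a constant; the component of least
    positive degree of the determinant is the trace of the leading term. *)
Lemma automorphism_trace c (phi : lieAut R) : (1 < c)%N ->
    (forall i, gamma R c (phi (y i) - y i)) ->
  order_ge c (trace (fun i => phi (y i) - y i)).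
Proof.
move=> c_gt1 phi_c; have c_pred : (c.-1.+1 = c)%N by rewrite prednK // ltnW.
have phi2 i : gamma R 2 (phi (y i) - y i) by exact: gamma_le (phi_c i).
pose psi := aut_inv phi; have psi_hom : lie_hom psi := lie_hom_inv phi.
pose J (f : R -> R) : 'M[{mpoly K[n]}]_n := \matrix_(i, k) fox k (f (y i)).
have JJ : J psi *m J phi = 1%:M.
  apply/matrixP => i k; rewrite !mxE.
  under eq_bigr do rewrite !mxE.
  rewrite -(fox_chain k (psi (y i)) (aut_hom phi)) // (aut_invK phi).
  by rewrite fox_gen eq_sym.
have unit_det : \det (J phi) \is a GRing.unit.
  by have := unitmx1 {mpoly K[n]} n; rewrite -JJ unitmx_mul => /andP[].
pose B := J phi - 1%:M.
have JE : J phi = 1%:M + B by rewrite addrC subrK.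
have B_order i j : order_ge c.-1 (B i j).
  rewrite !mxE (_ : _ - _ = fox j (phi (y i) - y i)).
    by apply: fox_order; rewrite c_pred.
  by rewrite foxB fox_gen eq_sym.
have -> : trace (fun i => phi (y i) - y i) = \tr B.
  by apply: eq_bigr => i _; rewrite !mxE foxB fox_gen !eqxx.
have c1_gt0 : (0 < c.-1)%N by rewrite -ltnS c_pred.
move=> m mc; have [m0|m0] := eqVneq m 0%MM.
  by apply: (@order_ge_sum _ _ c.-1) => // ; rewrite m0 mdeg0.
have := det_order c1_gt0 B_order; rewrite -JE => /(_ m).
rewrite mcoeffB mcoeffD mcoeff1 (negPf m0) (unit_coef unit_det m0) !add0r.
move=> /(_ _)/eqP; rewrite oppr_eq0 => det_m; apply/eqP/det_m.
by apply: leq_trans mc _; rewrite -{1}c_pred -addn1 leq_add2l.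
Qed.

End Trace.

(** * Leading terms with vanishing trace *)

Section NormalForm.
Variables (K : fieldType) (n : nat) (R : lieAlgType K) (y : 'I_n -> R).
Hypothesis n_ge4 : (4 <= n)%N.
Hypothesis genR : forall S : set R, is_subspace S ->
  (forall u v, S u -> S v -> S [lie u, v]) -> (forall i, S (y i)) ->
  forall r, S r.
Variable mu : R -> magnus K n.
Hypothesis mu_hom : lie_hom mu.
Hypothesis mu_gen : forall i, mu (y i) = magnus_gen K i.

Local Notation comm := (comm y).
Local Notation act := (act y).

(** Modulo the next term, the lower central series is spanned by left-normed
    commutators of generators. *)
Lemma gamma_words (S : set R) e : is_subspace S ->
    (forall a b p, size p = e -> S (act (comm a b) p)) ->
    gamma R e.+3 `<=` S ->
  gamma R e.+2 `<=` S.
Proof.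
have gen_lie (T : set R) u r : is_subspace T -> (forall k, T [lie u, y k]) ->
    (forall s, gamma R 2 s -> T [lie u, s]) -> T [lie u, r].
  move=> subT Ty T2; have [a ra] := linear_part genR r.
  rewrite -(subrK (\sum_i a i *: y i) r) lieDr; apply: subspaceD => //.
    exact: T2.
  elim/big_rec: _ => [|k s _ Ts]; first by rewrite lie0r; exact: subspace0.
  by rewrite lieDr lieZr; apply: subspaceD => //; exact: subspaceZ.
elim: e S => [|e IHe] S subS Swords Sdeep; apply: gamma_ind => // u v eu.
  apply: (gen_lie) => // [k|s s2]; last first.
    by apply: Sdeep; rewrite -[3%N]/(1 + 2)%N; exact: gamma_lie.
  rewrite lieC; apply: subspaceN => //; apply: (gen_lie) => // [l|s s2].
    exact: (Swords k l [::]).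
  by apply: Sdeep; rewrite -[3%N]/(1 + 2)%N; exact: gamma_lie.
apply: (gen_lie) => // [k|s s2]; last first.
  by apply: Sdeep; rewrite -addn2; exact: gamma_lie.
apply: (IHe [set u | S [lie u, y k]]) => // [|a b p pe|w w_deep].
- split=> [|a w1 w2 /= S1 S2]; first by rewrite /= lie0l; exact: subspace0.
  by rewrite lieDl lieZl; exact: subS.2.
- have := Swords a b (rcons p k); rewrite size_rcons pe => /(_ erefl).
  by rewrite -cats1 act_cat.
by apply: Sdeep; rewrite -addn1; exact: gamma_lie.
Qed.

Variable X : ('I_n -> R) -> Prop.
Variable c : nat.
Local Notation N := (c.+2).
Hypothesis XB : forall u v, X u -> X v -> X (u - v).
Hypothesis XZ : forall a u, X u -> X (a *: u).
Hypothesis X_deep : forall u, (forall i, gamma R N.+1 (u i)) -> X u.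
Hypothesis X_traceless : forall i a b p, size p = c -> a != i -> b != i ->
  X (single i (act (comm a b) p)).
Hypothesis X_monomial : forall i j a b p q, size p = c -> i != a -> j != b ->
  perm_eq (a :: p) (b :: q) ->
  X (single i (act (comm i a) p) - single j (act (comm j b) q)).

Definition monomial (s : seq 'I_n) : 'X_{1..n} := [multinom count_mem i s | i < n].

Definition word (m : 'X_{1..n}) : seq 'I_n :=
  flatten [seq nseq (m i) i | i <- enum 'I_n].

Lemma word_monomial s : perm_eq (word (monomial s)) s.
Proof.
apply/allP => i _ /=; rewrite /word count_flatten -map_comp.
rewrite sumnE big_map big_enum /= (bigD1 i) //= count_nseq /= eqxx mul1n mnmE.
rewrite big1 ?addn0 // => j /negPf ji.
by rewrite count_nseq /= ji.
Qed.

Lemma mdeg_monomial s : mdeg (monomial s) = size s.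
Proof.
rewrite mdegE -(sum1_size s) (eq_bigr (fun i => count_mem i s)) => [|i _]; last by rewrite mnmE.
elim: s => [|k s IHs]; first by rewrite big1 // big_nil.
rewrite big_cons -IHs (bigD1 k) //= eqxx [in RHS](bigD1 k) //= addnA; congr (_ + _)%N.
by apply: eq_bigr => i /negPf ik; rewrite eq_sym ik.
Qed.

Lemma prod_monomial s : \prod_(k <- s) 'X_k = 'X_[K, monomial s] :> {mpoly K[n]}.
Proof.
elim: s => [|k s IHs].
  by rewrite big_nil -mpolyX0; congr 'X_[_].
rewrite big_cons IHs -mpolyXD; congr 'X_[_]; apply/mnmP => i.
by rewrite mnmDE mnm1E !mnmE.
Qed.

Definition other (a : 'I_n) : 'I_n := odflt a [pick i | i != a].

Lemma other_neq a : other a != a.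
Proof.
rewrite /other; case: pickP => // no_other.
have [j] := fresh_ord (ltnW (ltnW n_ge4) : (size [:: a] < n)%N).
by rewrite inE no_other.
Qed.

(** A tuple whose trace is the product of the letters of s. A word that is a power
    of y_a still has such a tuple because the derivative is taken with respect
    to another variable. *)
Definition word_tuple (s : seq 'I_n) : 'I_n -> R :=
  if s is a :: p then single (other a) (act (comm (other a) a) p) else 0.

Definition poly_tuple (P : {mpoly K[n]}) : 'I_n -> R :=
  \sum_(m : 'X_{1..n < N}) P@_m *: word_tuple (word m).

Lemma poly_tupleP a P Q : poly_tuple (a *: P + Q) = a *: poly_tuple P + poly_tuple Q.
Proof.
rewrite /poly_tuple scaler_sumr -big_split /=; apply: eq_bigr => m _.
by rewrite mcoeffD mcoeffZ scalerDl scalerA.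
Qed.

Lemma poly_tuple0 : poly_tuple 0 = 0.
Proof. by rewrite /poly_tuple big1 // => m _; rewrite mcoeff0 scale0r. Qed.

Lemma poly_tupleX m : (mdeg m < N)%N -> poly_tuple 'X_[m] = word_tuple (word m).
Proof.
move=> mN; rewrite /poly_tuple (bigD1 (BMultinom mN)) //= mcoeffX eqxx scale1r.
rewrite big1 ?addr0 // => m' m'm; rewrite mcoeffX; case: eqP => [mE|_]; last first.
  by rewrite scale0r.
by case/eqP: m'm; apply: val_inj; rewrite /= mE.
Qed.

Definition reduces_to (u : 'I_n -> R) (P : {mpoly K[n]}) : Prop :=
  [/\ X (u - poly_tuple P), forall m, P@_m != 0 -> mdeg m = c.+1
    & order_ge N (trace mu u - P)].

Lemma X_0 : X 0.
Proof. by apply: X_deep => i; exact: gamma0. Qed.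

Lemma X_D u v : X u -> X v -> X (u + v).
Proof.
move=> Xu Xv; rewrite -[v]opprK; apply: XB => //.
by rewrite -scaleN1r; exact: XZ.
Qed.

Lemma reduces_toP a u v P Q : reduces_to u P -> reduces_to v Q ->
  reduces_to (a *: u + v) (a *: P + Q).
Proof.
move=> [XuP degP trP] [XvQ degQ trQ]; split.
- rewrite poly_tupleP opprD addrACA -scalerBr; apply: X_D => //; exact: XZ.
- move=> m; rewrite mcoeffD mcoeffZ.
  have [->|/degP //] := eqVneq (P@_m) 0; rewrite mulr0 add0r; exact: degQ.
rewrite (traceD mu_hom) (traceZ mu_hom) opprD addrACA -scalerBr.
by apply: order_geD => //; exact: order_geZ.
Qed.

Lemma reduces_to_0 u : X u -> order_ge N (trace mu u) -> reduces_to u 0.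
Proof.
move=> Xu tru; split; rewrite ?poly_tuple0 ?subr0 // => m.
by rewrite mcoeff0 eqxx.
Qed.

Lemma reduces_toN u P : reduces_to u P -> reduces_to (- u) (- P).
Proof.
move=> uP; have zero : reduces_to 0 0.
  apply: reduces_to_0; first exact: X_0.
  by rewrite /trace big1 => [|i _]; [exact: order_ge_0|exact: fox0].
by have := reduces_toP (-1) uP zero; rewrite !addr0 !scaleN1r.
Qed.

Lemma reduces_to_monomial i a p : size p = c -> i != a ->
  reduces_to (single i (act (comm i a) p)) 'X_[monomial (a :: p)].
Proof.
move=> pc ia; have ai : a != i by rewrite eq_sym.
split.
- rewrite poly_tupleX; last by rewrite mdeg_monomial /= pc.
  have := word_monomial (a :: p); case: (word _) => [|b q] bq.
    by move/perm_size: bq.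
  by apply: X_monomial => //; [rewrite other_neq|rewrite perm_sym].
- move=> m; rewrite mcoeffX; case: (monomial _ =P m) => [<- _|_]; last by rewrite eqxx.
  by rewrite mdeg_monomial /= pc.
rewrite (trace_single mu_hom) (fox_act mu_hom mu_gen) eqxx (negPf ia) mul1r mul0r subr0.
by rewrite -prod_monomial big_cons subrr; exact: order_ge_0.
Qed.

Lemma reduces_single i r : gamma R N r -> exists P, reduces_to (single i r) P.
Proof.
move: r; apply: gamma_words => [||r r_deep].
- split=> [|a u v [P uP] [Q vQ]].
    exists 0; rewrite single0; apply: reduces_to_0; first exact: X_0.
    by rewrite /trace big1 => [|k _]; [exact: order_ge_0|exact: fox0].
  exists (a *: P + Q); rewrite singleD singleZ; exact: reduces_toP.
- move=> a b p pc; have [<-|ab] := eqVneq a b.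
    exists 0; rewrite commxx act0 single0; apply: reduces_to_0; first exact: X_0.
    by rewrite /trace big1 => [|k _]; [exact: order_ge_0|exact: fox0].
  have [ai|ai] := eqVneq a i.
    by exists 'X_[monomial (b :: p)]; rewrite ai; apply: reduces_to_monomial; rewrite // -ai.
  have [bi|bi] := eqVneq b i.
    exists (- 'X_[monomial (a :: p)]); rewrite commC actN singleN bi.
    by apply/reduces_toN/reduces_to_monomial; rewrite // eq_sym.
  exists 0; apply: reduces_to_0; first exact: X_traceless.
  rewrite (trace_single mu_hom) (fox_act mu_hom mu_gen) eq_sym (negPf ai).
  by rewrite eq_sym (negPf bi) !mul0r subrr mul0r; exact: order_ge_0.
exists 0; apply: reduces_to_0.
  by apply: X_deep => k; exact: gamma_single.
by apply: (trace_order genR mu_hom mu_gen) => k; exact: gamma_single.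
Qed.

(** Modulo X a tuple only depends on its trace. *)
Lemma X_of_trace u : (forall i, gamma R N (u i)) -> order_ge N (trace mu u) -> X u.
Proof.
move=> u_gamma tru.
have [P [XuP degP trP]] : exists P, reduces_to u P.
  have -> : u = \sum_i single i (u i).
    apply/funext => k; rewrite fct_sumE (bigD1 k) //= /single eqxx big1 ?addr0 //.
    by move=> i /negPf ik; rewrite eq_sym ik.
  elim/big_rec: _ => [|i v _ [P vP]].
    exists 0; apply: reduces_to_0; first exact: X_0.
    by rewrite /trace big1 => [|k _]; [exact: order_ge_0|exact: fox0].
  have [Q uQ] := reduces_single i (u_gamma i).
  by exists (1 *: Q + P); rewrite -[single _ _]scale1r; exact: reduces_toP.
suff P0 : P = 0 by move: XuP; rewrite P0 poly_tuple0 subr0.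
apply/mpolyP => m; rewrite mcoeff0; apply/eqP; apply: contraT => Pm.
have := order_geB tru trP; rewrite subKr => /(_ m); rewrite (degP m Pm).
by move=> /(_ (ltnSn _)) Pm0; rewrite Pm0 eqxx in Pm.
Qed.

End NormalForm.
(** * Density *)

Lemma uniq_perm_map (T : finType) (s t : seq T) : uniq s -> uniq t ->
  size s = size t -> exists f : {perm T}, map f s = t.
Proof.
elim: s t => [|x s IHs] [|z t] //=; first by exists 1%g.
move=> /andP[xs us] /andP[zt ut] [st]; have [f fs] := IHs t us ut st.
exists (f * tperm (f x) z)%g; rewrite permM tpermL; congr (_ :: _).
rewrite -fs; apply/eq_in_map => k ks; rewrite permM tpermD //.
  by apply: contraNneq xs => /perm_inj ->.
by apply: contraNneq zt => ->; rewrite -fs map_f.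
Qed.

Section Generation.
Variables (K : fieldType) (n : nat) (L : lieAlgType K) (x : 'I_n -> L).
Hypothesis freeL : free_on x.
Variables (R : lieAlgType K) (pi : L -> R).
Hypothesis quotR : is_quotient (relation_ideal L) pi.
Hypothesis charK0 : [pchar K] =i pred0.
Hypothesis n_ge4 : (4 <= n)%N.

Local Notation y := (fun i => pi (x i)).
Local Notation act := (act y).
Local Notation comm := (comm y).

Let laws : variety_laws R := quotient_laws quotR.

Let genR : forall S : set R, is_subspace S ->
  (forall u v, S u -> S v -> S [lie u, v]) -> (forall i, S (y i)) ->
  forall r, S r := quotient_ind freeL quotR.

Lemma central_ideal (u s : R) : central u -> central [lie u, s].
Proof.
move=> cu v v2; have -> : [lie v, [lie u, s]] = [lie v, u, s] - [lie [lie v, s], u].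
  by rewrite lie_leibniz addrC addKr.
rewrite cu // lie0l cu ?subr0 //; apply: (@gamma_le _ _ _ 3) => //.
by rewrite -[3%N]/(2 + 1)%N; exact: gamma_lie.
Qed.

(** An endomorphism that moves the generators by elements centralizing the
    derived algebra moves every element in this way, hence fixes the second
    derived algebra. *)
Lemma central_shift_fix (f : R -> R) v w : lie_hom f ->
  (forall i, central (f (y i) - y i)) -> gamma R 2 v -> gamma R 2 w ->
  f [lie v, w] = [lie v, w].
Proof.
move=> fh fy v2 w2.
have f_central r : central (f r - r).
  move: r; apply: (genR (S := fun r => central (f r - r))) => // [|u s cu cs].
    split=> [|a u s cu cs]; first by rewrite (hom0 fh) subrr; exact: central0.
    rewrite (homD fh) (homZ fh) opprD addrACA -scalerBr; apply: centralD => //.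
    by move=> z z2; rewrite lieZr cu // scaler0.
  rewrite (hom_lie fh) (_ : _ - _ = [lie f u - u, f s] - [lie f s - s, u]).
    by apply: centralD; [exact: central_ideal|apply: centralN; exact: central_ideal].
  by rewrite !lieBl (lieC (f s) u) (lieC s u); zmodule.
rewrite (hom_lie fh); apply/eqP; rewrite -subr_eq0; apply/eqP.
rewrite (_ : _ - _ = [lie f v, f w - w] - [lie w, f v - v]).
  by rewrite !f_central ?subr0 //; exact: gamma_hom.
by rewrite !lieBr (lieC w (f v)) (lieC w v); zmodule.
Qed.

Lemma second_derived_automorphism i v w : gamma R 2 v -> gamma R 2 w ->
  exists phi : lieAut R, phi (y i) = y i + [lie v, w] /\
    forall k, k != i -> phi (y k) = y k.
Proof.
move=> v2 w2; have cu : central [lie v, w] by exact: central_lie.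
have shift (u : R) : central u -> exists f : R -> R,
    [/\ lie_hom f, f (y i) = y i + u, forall k, k != i -> f (y k) = y k
    & forall k, central (f (y k) - y k)].
  move=> u_central.
  have [f [fh fy]] := quotient_hom freeL quotR (fun k => y k + single i u k) laws.
  exists f; split=> // [|k ki|k]; rewrite fy /single ?eqxx //.
    by rewrite (negPf ki) addr0.
  by rewrite addrC addKr; case: eqP => // _; exact: central0.
have [[f [fh fi fk fc]] [g [gh gi gk gc]]] := (shift _ cu, shift _ (centralN cu)).
have comp_hom (h k : R -> R) : lie_hom h -> lie_hom k -> lie_hom (k \o h).
  move=> hh kh; split=> [a r s|r s] /=.
    by rewrite (homD hh) (homZ hh) (homD kh) (homZ kh).
  by rewrite (hom_lie hh) (hom_lie kh).
have fgK : cancel f g.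
  apply: (quotient_hom_inj freeL quotR (f := g \o f) (g := id)) => [||k] //=.
    exact: comp_hom.
  have [->|ki] := eqVneq k i; last by rewrite fk // gk.
  by rewrite fi (homD gh) gi (central_shift_fix gh gc v2 w2) subrK.
have gfK : cancel g f.
  apply: (quotient_hom_inj freeL quotR (f := f \o g) (g := id)) => [||k] //=.
    exact: comp_hom.
  have [->|ki] := eqVneq k i; last by rewrite gk // fk.
  by rewrite gi (homB fh) fi (central_shift_fix fh fc v2 w2) addrK.
by exists (LieAut fh fgK gfK).
Qed.

Let H := generated_subgroup (tame pi `|` omegas n_ge4 y).

Lemma H_incl g : (tame pi `|` omegas n_ge4 y) g -> H g.
Proof. exact: sub_gen_smallest. Qed.

Lemma H_one : H 1%g.
Proof. by move=> H' [[/set_mem]]. Qed.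

Lemma H_mul g h : H g -> H h -> H (g * h)%g.
Proof.
move=> Hg Hh H' H'P; have [closed_H' _] := H'P.
have gH' : g \in mem H' by apply: mem_set; exact: (Hg H' H'P).
have hH' : h \in mem H' by apply: mem_set; exact: (Hh H' H'P).
by have /set_mem := group_closedM closed_H' gH' hH'.
Qed.

Lemma H_inv g : H g -> H (g^-1)%g.
Proof.
move=> Hg H' H'P; have [closed_H' _] := H'P.
have gH' : g \in mem H' by apply: mem_set; exact: (Hg H' H'P).
by have /set_mem := group_closedV closed_H' gH'.
Qed.

Lemma H_linear (A : 'M[K]_n) : A \in unitmx ->
  exists phi : lieAut R, [/\ H phi, forall i, phi (y i) = \sum_j A i j *: y j
    & forall i, aut_inv phi (y i) = \sum_j invmx A i j *: y j].
Proof.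
move=> /(tame_linear freeL quotR)[phi [tame_phi phiy phiiy]].
by exists phi; split=> //; apply: H_incl; left.
Qed.

Lemma H_elementary j r : avoids x pi j r ->
  exists phi : lieAut R, [/\ H phi, phi (y j) = y j + r,
    aut_inv phi (y j) = y j - r,
    forall i, i != j -> phi (y i) = y i
    & forall i, i != j -> aut_inv phi (y i) = y i].
Proof.
move=> /(tame_elementary freeL quotR)[phi [tame_phi ? ? ? ?]].
by exists phi; split=> //; apply: H_incl; left.
Qed.

Lemma avoids_scaled j a i : i != j -> avoids x pi j (a *: y i).
Proof. by move=> ij; apply: (avoidsZ quotR); exact: avoids_gen. Qed.

Let derR : forall m : 'I_n -> R,
  exists d : R -> R, derivation d /\ forall i, d (y i) = m i :=
  quotient_derivation freeL quotR.

Lemma bracket_iterE w k b : bracket_iter w k (y b) = act w (nseq k b).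
Proof. by elim: k w => [//|k IHk] w; rewrite /bracket_iter iterSr -/(bracket_iter _ _ _) IHk. Qed.

(** The endomorphism omega_(k + 1) is invertible because its increment lies in the
    second derived algebra; conjugation by a permutation of the generators then
    gives all choices of indices. *)
Lemma leading_omega k a b c d : uniq [:: a; b; c; d] ->
  leading y H (4 + k) (single a [lie act (comm a b) (nseq k a), comm c d]).
Proof.
move=> uniq_abcd.
pose idx j (hj : (j < 4)%N) := widen_ord n_ge4 (Ordinal hj).
pose i1 := @idx 0%N isT; pose i2 := @idx 1%N isT.
pose i3 := @idx 2%N isT; pose i4 := @idx 3%N isT.
have [s [sa sb sc sd]] : exists s : {perm 'I_n}, map s [:: i1; i2; i3; i4] = [:: a; b; c; d].
  by apply: uniq_perm_map.
pose f := [lie act (comm i1 i2) (nseq k i1), comm i3 i4].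
have word2 (p : seq 'I_n) i j : gamma R 2 (act (comm i j) p).
  by apply: act_gamma2; exact: comm_gamma.
have [w [wi1 wk]] := second_derived_automorphism i1
  (word2 (nseq k i1) i1 i2) (comm_gamma y i3 i4).
have Hw : H w.
  apply: H_incl; right; exists k.+1 => //; split=> //.
  by rewrite wi1 -bracket_iterE.
have Xf : leading y H (4 + k) (single i1 f).
  split=> [i|].
    apply: gamma_single; rewrite addnC -[(k + 4)%N]/(k + (2 + 2))%N addnA.
    apply: gamma_lie; last exact: comm_gamma.
    by rewrite addnC -{1}(size_nseq k i1); apply: act_gamma; exact: comm_gamma.
  exists w => // i; rewrite /single; have [->|ii1] := eqVneq i i1.
    by rewrite wi1 addrAC addrK subrr; exact: gamma0.
  by rewrite wk // subrr subr0; exact: gamma0.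
have [g [Hg gy _]] := H_linear (unitmx_perm K s).
have g_perm i : g (y i) = y (s i).
  rewrite gy (bigD1 (s i)) //= !mxE eqxx scale1r big1 ?addr0 // => j /negPf ji.
  by rewrite !mxE eq_sym ji scale0r.
have gV i : aut_inv g (y i) = \sum_j (j == (s^-1)%g i)%:R *: y j.
  rewrite (bigD1 ((s^-1)%g i)) //= eqxx scale1r big1 ?addr0 => [|j /negPf ->]; last first.
    by rewrite scale0r.
  by rewrite -{1}(permKV s i) -g_perm aut_funK.
have := leading_conj H_mul H_inv Hg gV Xf.
move=> Xg; apply: (leading_ext Xg) => i.
have gh := aut_hom g.
have g_act u q : g (act u q) = act (g u) (map s q).
  by elim: q u => //= j q IHq u; rewrite IHq (hom_lie gh) g_perm.
have g_f : g f = [lie act (comm a b) (nseq k a), comm c d].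
  have g_comm e1 e2 : g (comm e1 e2) = comm (s e1) (s e2).
    by rewrite [LHS](hom_lie gh) !g_perm.
  rewrite /f (hom_lie gh) g_act !g_comm map_nseq.
  by rewrite sa sb sc sd.
rewrite (bigD1 i1) //= [single i1 f i1]/single eqxx g_f big1 => [|j /negPf ji1]; last first.
  by rewrite /single ji1 (hom0 gh) scaler0.
rewrite addr0 /single -sa; have -> : (i1 == (s^-1)%g i) = (i == s i1).
  by apply/eqP/eqP => [->|->]; rewrite ?permKV ?permK.
by case: eqP => _; rewrite ?scale1r ?scale0r.
Qed.

(** The combinatorial results, applied to the leading terms of the subgroup
    generated by the tame automorphisms and the omega_k. *)
Lemma leading_of_trace (mu : R -> magnus K n) c u : lie_hom mu ->
    (forall i, mu (y i) = magnus_gen K i) ->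
    (forall i, gamma R c.+2 (u i)) -> order_ge c.+2 (trace mu u) ->
  leading y H c.+2 u.
Proof.
move=> mu_hom mu_gen.
have XB e v w : (1 < e)%N -> leading y H e v -> leading y H e w ->
  leading y H e (v - w) by move=> e1; exact: (leadingB genR H_one H_mul H_inv e1).
have XZ e a v : (1 < e)%N -> leading y H e v -> leading y H e (a *: v).
  by move=> e1; exact: (leadingZ genR H_one H_mul H_inv e1 charK0 H_linear).
have X0 e : leading y H e 0.
  by apply: (leading_deep y H_one) => i; exact: gamma0.
have X_polarize e k l i f d : (1 < e)%N -> k != l ->
    derivation d -> (forall j, d (y j) = single k (y l) j) ->
    leading y H e (single i f) ->
    leading y H e (single i (d f) - (if i == l then single k f else 0)).
  move=> e1; exact: (leading_polarize genR H_one H_mul H_inv e1 charK0 H_linear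
    avoids_scaled H_elementary).
have X_bracket e e' i j f w d1 d2 : (1 < e)%N -> (1 < e')%N ->
    i != j -> avoids x pi j w -> gamma R e' w -> leading y H e (single i f) ->
    derivation d1 -> (forall k, d1 (y k) = single j w k) ->
    derivation d2 -> (forall k, d2 (y k) = single i f k) ->
    leading y H (e + e').-1 (single i (d1 f) - single j (d2 w)).
  by move=> e1; exact: (leading_bracket genR H_mul H_inv e1 H_elementary).
have X_elementary e j r : avoids x pi j r -> gamma R e r -> leading y H e (single j r).
  exact: (leading_elementary H_elementary).
have avoid_gen j i : i != j -> avoids x pi j (y i) by exact: avoids_gen.
have avoid_lie j u' v : avoids x pi j u' -> avoids x pi j v ->
  avoids x pi j [lie u', v] by exact: (avoids_lie quotR).
have combinatorics := (X1_traceless charK0 n_ge4 laws derR avoid_gen avoid_lie X0 XB XZ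
  X_polarize X_bracket X_elementary leading_omega).
apply: (X_of_trace n_ge4 genR mu_hom mu_gen (X := leading y H c.+2)) => //.
- by move=> v w; exact: XB.
- by move=> a v; exact: XZ.
- by move=> v; exact: (leading_deep y H_one).
- by move=> i a b p <-; exact: combinatorics.
move=> i j a b p q <-; exact: (X_monomial charK0 n_ge4 laws derR avoid_gen avoid_lie X0 XB XZ
  X_polarize X_bracket X_elementary leading_omega).
Qed.

(** A linear automorphism matches phi modulo weight 2. If h matches phi modulo
    weight c, the leading term of h^-1 phi has trace zero, so it is the leading
    term of some element of H, and multiplying h by this element matches phi
    modulo weight c + 1. *)
Lemma approximation c (phi : lieAut R) :
  exists2 h, H h & forall i, gamma R c (h (y i) - phi (y i)).
Proof.
have [mu [mu_hom mu_gen]] := quotient_hom freeL quotR (@magnus_gen K n) (magnus_laws K n).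
have mu_order := fox_order genR mu_hom mu_gen.
pose lin k r := (fox mu k r)@_0.
have lin_gamma2 k r : gamma R 2 r -> lin k r = 0.
  by move=> /(mu_order k); apply; rewrite mdeg0.
have linD k r s : lin k (r + s) = lin k r + lin k s.
  by rewrite /lin (foxD mu_hom) mcoeffD.
have linZ k a r : lin k (a *: r) = a * lin k r.
  by rewrite /lin (foxZ mu_hom) mcoeffZ.
have lin_gen k i : lin k (y i) = (k == i)%:R.
  by rewrite /lin (fox_gen mu_gen) -[_%:R]scale1r; case: eqP => _;
    rewrite ?mulr1n ?mulr0n ?scaler0 ?mcoeff0 // scale1r mcoeff1 eqxx.
have lin_sum k (a : 'I_n -> K) (z : 'I_n -> R) :
    lin k (\sum_j a j *: z j) = \sum_j a j * lin k (z j).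
  by elim/big_rec2: _ => [|j r s _ <-]; [rewrite lin_gamma2 //; exact: gamma0|rewrite linD linZ].
have lin_part r : gamma R 2 (r - \sum_j lin j r *: y j).
  have [a ra] := linear_part genR r.
  rewrite (_ : \sum_j _ = \sum_j a j *: y j) //; apply: eq_bigr => j _.
  rewrite -{1}(subrK (\sum_i a i *: y i) r) linD lin_gamma2 // add0r lin_sum.
  rewrite (bigD1 j) //= lin_gen eqxx mulr1 big1 ?addr0 // => i /negPf ij.
  by rewrite lin_gen eq_sym ij mulr0.
elim: c => [|[|[|c]] IHc]; try by exists 1%g; [exact: H_one|].
  pose A := \matrix_(i, k) lin k (phi (y i)).
  pose B := \matrix_(i, k) lin k (aut_inv phi (y i)).
  have BA : B *m A = 1%:M.
    apply/matrixP => i k; rewrite !mxE; under eq_bigr do rewrite !mxE.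
    rewrite -lin_sum -[RHS]/((i == k)%:R) eq_sym -lin_gen -{2}(aut_invK phi (y i)).
    set z := aut_inv phi (y i).
    rewrite -[in RHS](subrK (\sum_j lin j z *: y j) z) (homD (aut_hom phi)) linD.
    rewrite [lin k (phi (z - _))]lin_gamma2 ?add0r; last exact: (gamma_hom (aut_hom phi)).
    by rewrite (hom_sum (aut_hom phi)); congr lin; apply: eq_bigr => j _;
      rewrite (homZ (aut_hom phi)).
  have [_ unitA] := mulmx1_unit BA.
  have [g [Hg gy _]] := H_linear unitA; exists g => // i.
  rewrite gy -opprB; apply: gammaN; under eq_bigr do rewrite mxE.
  exact: lin_part.
have [h Hh hphi] := IHc.
pose theta := (h^-1 * phi)%g.
have theta_c i : gamma R c.+2 (theta (y i) - y i).
  rewrite -{2}(aut_funK h (y i)) /= -(homB (lie_hom_inv h)).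
  apply: (gamma_hom (lie_hom_inv h)); rewrite -opprB; exact: gammaN.
have := automorphism_trace genR mu_hom mu_gen (isT : 1 < c.+2)%N theta_c.
move=> /(leading_of_trace mu_hom mu_gen theta_c)[_ [h' Hh' h'y]].
exists (h * h')%g => [|i]; first exact: H_mul.
rewrite (_ : _ - _ = h (h' (y i) - y i - (theta (y i) - y i))).
  exact: (gamma_hom (aut_hom h)).
by rewrite !(homB (aut_hom h)) /= aut_invK; zmodule.
Qed.

End Generation.

Section Topology.
Variables (K : fieldType) (n : nat) (R : lieAlgType K) (y : 'I_n -> R).

Lemma aut_topology_nbhs (O : set (aut_topology y)) (phi : lieAut R) :
  open O -> O phi ->
  exists c, forall h : lieAut R,
    (forall i, gamma R c (h (y i) - phi (y i))) -> O h.
Proof.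
move=> [_ [B B_open <-] <-] B_phi.
(* Otherwise there would be a sequence outside O that converges to phi. *)
apply: contrapT => no_c.
have /choice[h hP] : forall c, exists h : lieAut R,
    (forall i, gamma R c (h (y i) - phi (y i))) /\
    ~ B (end_coords y (end_of_aut h)).
  move=> c; apply: contrapT => no_h; apply: no_c; exists c => h h_phi.
  by apply: contrapT => nBh; apply: no_h; exists h.
pose u c := end_coords y (end_of_aut (h c)).
have u_phi : u @ \oo --> end_coords y (end_of_aut phi).
  apply/cvg_sup => i A [_ [[C C_open <-] C_phi]] CA.
  have [c _ cC] : nbhs (phi (y i) : power_series_topology R) C.
    by apply: open_nbhs_nbhs; split.
  exists c => // d cd; apply: CA; rewrite /preimage /=.
  rewrite -[X in C X](addrNK (phi (y i))) addrC; apply: cC.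
  exact: gamma_le cd ((hP d).1 i).
have : nbhs (end_coords y (end_of_aut phi)) B by apply: open_nbhs_nbhs; split.
by move=> /u_phi[c _ cB]; apply: (hP c).2; apply: (cB c) => /=.
Qed.

End Topology.

Theorem theorem1p1 (K : fieldType) (charK0 : [pchar K] =i pred0)
    (n : nat) (hn : (4 <= n)%N)
    (L : lieAlgType K) (x : 'I_n -> L) (freeL : free_on x)
    (R : lieAlgType K) (pi : L -> R)
    (quotR : is_quotient (relation_ideal L) pi) :
  let y : 'I_n -> R := fun i => pi (x i) in
  dense (generated_subgroup (tame pi `|` omegas hn y) : set (aut_topology y)).
Proof.
move=> y O [phi O_phi] O_open.
have [c O_c] := aut_topology_nbhs O_open O_phi.
have [h Hh h_phi] := approximation freeL quotR charK0 hn c phi.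
by exists h; split=> //; exact: O_c.
Qed.
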